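(* The isolation problem for stateful networks under the FIFO network semantics is undecidable, even when restricted to networks all of whose middleboxes are finite-state and which have no forwarding loops.
   Context: A network is $\mathsf{N}=(H\cup M,E,P)$: a finite undirected graph whose nodes are a finite set $H$ of hosts and a finite set $M$ of middleboxes, with edge set $E$, and packet set $P=H\times H\times T$ for a finite tag set $T$ (a packet $(s,d,t)$ has source $s$, destination $d$, tag $t$). Each host $h$ has a set $P_h\subseteq P$ of packets it may send. A middlebox $m$ has as ports $\mathsf{Pr}$ its adjacent edges and a forwarding transducer $(\Sigma,\Gamma,Q_m,q^0_m,\delta_m)$ with $\Sigma=P\times\mathsf{Pr}$, $\Gamma=2^{P\times\mathsf{Pr}}$, state set $Q_m$, initial state $q^0_m$, and transition relation $\delta_m\subseteq Q_m\times\Sigma\times\Gamma\times Q_m$; it is finite-state if $Q_m$ is finite. If $\delta_m(q,(p,pr))=\emptyset$ the middlebox enters a special abort state upon receiving $p$ on port $pr$ in state $q$. Each edge $\{u,v\}$ yields two directed channels $(u,v)$ and $(v,u)$ of unbounded capacity. In the FIFO semantics a configuration consists of the content of each channel (a finite sequence of packets) and the state of every middlebox; initially all channels are empty and middleboxes are in their initial states. A successor configuration is obtained either by a host $h$ appending some $p\in P_h$ to the channel towards a neighbour, or by a middlebox $m$ in state $q$ removing the packet $p$ at the head of an ingress channel (associated with port $pr$), choosing $(o,q')$ with $(q,(p,pr),o,q')\in\delta_m$, moving to $q'$ and appending each $(p',pr')\in o$ to the tail of the egress channel of port $pr'$. A run is a sequence of successive configurations from the initial configuration. The isolation problem: given a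 network, a set $H_i\subseteq H$ and a set $P_i\subseteq P$, answer True iff there is no run in which a host from $H_i$ receives a packet from $P_i$. Forwarding loops: augment every packet sent by a host with a unique packet id which middleboxes neither depend on nor change (forwarded packets inherit the id); the network has a forwarding loop if there is a run in which a packet with the same id is received by the same middlebox twice. *)

(* Defs.v *)
From HB Require Import structures.
From mathcomp Require Import all_boot.

Set Implicit Arguments.
Unset Strict Implicit.
Unset Printing Implicit Defensive.

(** * Partial recursive functions *)

(** [recf n] is Kleene's class of n-ary partial recursive functions (as
    programs).  In [rprec] the recursion is on the first argument; [g] receives
    the predecessor, the recursive value and the parameters, in that order. *)
Inductive recf : nat -> Type :=
| rzero n : recf n
| rsucc : recf 1
| rproj n (i : 'I_n) : recf n
| rcomp n k (f : recf k) (g : 'I_k -> recf n) : recf n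
| rprec n (f : recf n) (g : recf n.+2) : recf n.+1
| rmu n (f : recf n.+1) : recf n.

(** [reval f v y]: the computation of [f] on [v] terminates with value [y]. *)
Fixpoint reval n (f : recf n) {struct f} : n.-tuple nat -> nat -> Prop :=
  match f in recf n return n.-tuple nat -> nat -> Prop with
  | rzero _ => fun _ y => y = 0
  | rsucc => fun v y => y = (thead v).+1
  | rproj _ i => fun v y => y = tnth v i
  | rcomp n k f g => fun v y =>
      exists w : k.-tuple nat,
        (forall i, reval (g i) v (tnth w i)) /\ reval f w y
  | rprec n f g => fun v =>
      let params : n.-tuple nat := [tuple of behead v] in
      (fix loop (k : nat) : nat -> Prop :=
         match k with
         | 0 => reval f params
         | k'.+1 => fun y =>
             exists z, loop k' z /\ reval g [tuple of k' :: z :: params] y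
         end) (thead v)
  | rmu n f => fun v y =>
      reval f [tuple of y :: v] 0 /\
      forall z, z < y -> exists k, reval f [tuple of z :: v] k.+1
  end.

Lemma reval_functional n (f : recf n) v y z :
  reval f v y -> reval f v z -> y = z.
Proof.
elim: f v y z => {n} [n|  |n i|n k f IHf g IHg|n f IHf g IHg|n f IHf] v y z /=.
- by move=> -> ->.
- by move=> -> ->.
- by move=> -> ->.
- move=> [w [gw fw]] [w' [gw' fw']]; have eq_w : w = w'.
    by apply: eq_from_tnth => i; apply: IHg (gw i) (gw' i).
  by rewrite -eq_w in fw'; apply: IHf fw fw'.
- elim: (thead v) y z => [|k IHk] y z; first exact: IHf.
  by move=> [a [La ga]] [b [Lb]]; rewrite -(IHk _ _ La Lb); apply: IHg.
- move=> [fy ltf] [fz ltg]; case: (ltngtP y z) => // [/ltg|/ltf] [k fk].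
    by have := IHf _ _ _ fy fk.
  by have := IHf _ _ _ fz fk.
Qed.

(** * Networks *)

(** The undirected graph is simple, so a port of a middlebox (an adjacent edge)
    is identified with the neighbour at its other end. *)
Record topology := Topology {
  host : finType;
  mbox : finType;
  tag : finType;
  adj : rel (host + mbox);
  adj_sym : symmetric adj;
  adj_irrefl : irreflexive adj
}.

Definition node (G : topology) : finType := (host G + mbox G)%type.

(** (source, destination, tag) *)
Definition packet (G : topology) : finType := (host G * host G * tag G)%type.

Definition port (G : topology) (m : mbox G) : finType :=
  {v : node G | adj (inr m) v}.

Record network := Network {
  top :> topology;
  sendable : host top -> {set packet top};
  state : mbox top -> Type;
  init : forall m, state m;
  delta : forall m, state m -> packet top * port m ->
            {set packet top * port m} -> state m -> Prop
}.

Definition finite_state (N : network) : Prop :=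
  forall m : mbox N, exists n (e : 'I_n -> state m), forall q, exists i, e i = q.

(** * FIFO semantics *)

(** [X] is the type of the items travelling in the channels: packets, or packets
    carrying an id.  [chan c u v] is the content of the channel (u, v), head
    first; it stays empty when u and v are not adjacent.  The middlebox state
    [None] is the abort state. *)
Record config (N : network) (X : Type) := Config {
  chan : node N -> node N -> seq X;
  mstate : forall m : mbox N, option (state m)
}.

Section Semantics.

Variables (N : network) (X : Type).
Implicit Types (c : node N -> node N -> seq X).

Definition initial : config N X :=
  Config (fun _ _ => [::]) (fun m => Some (init m)).

Definition append c (u v : node N) (x : X) : node N -> node N -> seq X :=
  fun a b => if (a == u) && (b == v) then rcons (c a b) x else c a b.

Definition pop c (u v : node N) : node N -> node N -> seq X :=
  fun a b => if (a == u) && (b == v) then behead (c a b) else c a b.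

Definition emit (m : mbox N) (s : seq (X * port m)) c :=
  foldl (fun c' (x : X * port m) => append c' (inr m) (val x.2) x.1) c s.

End Semantics.

Arguments initial {N X}.

(** The order in which the elements of an output set are appended is arbitrary:
    any enumeration [s] of [o] may be used. *)
Inductive step (N : network) : config N (packet N) -> config N (packet N) -> Prop :=
| HostStep c (h : host N) (v : node N) (p : packet N) :
    adj (inl h) v -> p \in sendable h ->
    step c (Config (append (chan c) (inl h) v p) (mstate c))
| MboxStep c (m : mbox N) (pr : port m) (p : packet N) r q o q' s :
    mstate c m = Some q ->
    chan c (val pr) (inr m) = p :: r ->
    delta q (p, pr) o q' ->
    perm_eq s (enum o) ->
    step c (Config (emit s (pop (chan c) (val pr) (inr m)))
                   (dfwith (mstate c) (Some q')))
| AbortStep c (m : mbox N) (pr : port m) (p : packet N) r q :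
    mstate c m = Some q ->
    chan c (val pr) (inr m) = p :: r ->
    (forall o q', ~ delta q (p, pr) o q') ->
    step c (Config (pop (chan c) (val pr) (inr m))
                   (dfwith (mstate c) (None : option (state m)))).

Inductive reachable (N : network) : config N (packet N) -> Prop :=
| ReachInit : reachable initial
| ReachStep c c' : reachable c -> step c c' -> reachable c'.

(** Hosts never remove packets from their ingress channels, so a host has
    received exactly the packets present in these channels. *)
Definition received (N : network) (c : config N (packet N)) (h : host N)
    (p : packet N) : Prop :=
  exists u : node N, p \in chan c u (inl h).

Definition isolation (N : network) (Hi : {set host N}) (Pi : {set packet N}) :
    Prop :=
  ~ exists c h p, [/\ reachable c, h \in Hi, p \in Pi & received c h p].

(** * Forwarding loops *)

(** [id_run ids rcv c]: some run of the network with id-carrying packets ends in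
    [c]; [ids] lists the ids given by the hosts so far, and [rcv] has one entry
    (m, i) for each time middlebox m received a packet with id i. *)
Inductive id_run (N : network) :
    seq nat -> seq (mbox N * nat) -> config N (nat * packet N) -> Prop :=
| IdInit : id_run [::] [::] initial
| IdHostStep ids rcv c (h : host N) (v : node N) (p : packet N) i :
    id_run ids rcv c ->
    adj (inl h) v -> p \in sendable h -> i \notin ids ->
    id_run (i :: ids) rcv
      (Config (append (chan c) (inl h) v (i, p)) (mstate c))
| IdMboxStep ids rcv c (m : mbox N) (pr : port m) i (p : packet N) r q o q' s :
    id_run ids rcv c ->
    mstate c m = Some q ->
    chan c (val pr) (inr m) = (i, p) :: r ->
    delta q (p, pr) o q' ->
    perm_eq s (enum o) ->
    id_run ids ((m, i) :: rcv)
      (Config (emit [seq ((i, x.1), x.2) | x <- s]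
                    (pop (chan c) (val pr) (inr m)))
              (dfwith (mstate c) (Some q')))
| IdAbortStep ids rcv c (m : mbox N) (pr : port m) i (p : packet N) r q :
    id_run ids rcv c ->
    mstate c m = Some q ->
    chan c (val pr) (inr m) = (i, p) :: r ->
    (forall o q', ~ delta q (p, pr) o q') ->
    id_run ids ((m, i) :: rcv)
      (Config (pop (chan c) (val pr) (inr m))
              (dfwith (mstate c) (None : option (state m)))).

Definition forwarding_loop (N : network) : Prop :=
  exists ids (rcv : seq (mbox N * nat)) c, id_run ids rcv c /\ ~~ uniq rcv.

(** * Finite descriptions of the instances of the isolation problem *)

(** Hosts are 0, ..., H-1, middleboxes 0, ..., M-1, tags 0, ..., T-1; as a node
    of the graph, host h has number h and middlebox m has number H + m. *)
Definition rpacket := (nat * nat * nat)%type.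

(** (q, (p, pr), o, q') in the transition relation; ports are given by the node
    number of the neighbour. *)
Record rule := Rule {
  r_src : nat;
  r_packet : rpacket;
  r_port : nat;
  r_out : seq (rpacket * nat);
  r_dst : nat
}.

(** The states are 0, ..., [md_last], and 0 is the initial one. *)
Record mbox_desc := MboxDesc {
  md_last : nat;
  md_rules : seq rule
}.

Record instance := Instance {
  i_hosts : nat;
  i_tags : nat;
  i_edges : seq (nat * nat);
  i_sends : seq (nat * rpacket);
  i_mboxes : seq mbox_desc;
  i_Hi : seq nat;
  i_Pi : seq rpacket
}.

Section NetworkOfInstance.

Variable x : instance.

Local Notation rhost := 'I_(i_hosts x).
Local Notation rmbox := 'I_(size (i_mboxes x)).

Definition node_num (u : rhost + rmbox) : nat :=
  match u with inl h => h : nat | inr m => i_hosts x + m end.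

Definition inst_adj : rel (rhost + rmbox) := fun u v =>
  (u != v) && (((node_num u, node_num v) \in i_edges x)
               || ((node_num v, node_num u) \in i_edges x)).

Lemma inst_adj_sym : symmetric inst_adj.
Proof. by move=> u v; rewrite /inst_adj eq_sym orbC. Qed.

Lemma inst_adj_irrefl : irreflexive inst_adj.
Proof. by move=> u; rewrite /inst_adj eqxx. Qed.

Definition inst_top : topology :=
  @Topology rhost rmbox 'I_(i_tags x) inst_adj inst_adj_sym inst_adj_irrefl.

Definition packet_num (p : packet inst_top) : rpacket :=
  let: (s, d, t) := p in (s : nat, d : nat, t : nat).

Definition inst_mbox (m : mbox inst_top) : mbox_desc :=
  tnth (in_tuple (i_mboxes x)) m.

Definition inst_delta (m : mbox inst_top) (q : 'I_(md_last (inst_mbox m)).+1)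
    (a : packet inst_top * port m) (o : {set packet inst_top * port m})
    (q' : 'I_(md_last (inst_mbox m)).+1) : Prop :=
  has (fun r => [&& r_src r == q,
                    r_packet r == packet_num a.1,
                    r_port r == node_num (val a.2),
                    o == [set b | (packet_num b.1, node_num (val b.2)) \in r_out r]
                  & r_dst r == q'])
      (md_rules (inst_mbox m)).

Definition inst_net : network :=
  @Network inst_top
    (fun h => [set p | (h : nat, packet_num p) \in i_sends x])
    (fun m => 'I_(md_last (inst_mbox m)).+1)
    (fun m => ord0)
    inst_delta.

Definition inst_Hi : {set host inst_net} := [set h : rhost | (h : nat) \in i_Hi x].

Definition inst_Pi : {set packet inst_net} := [set p | packet_num p \in i_Pi x].

End NetworkOfInstance.

(** * Numerical codes of instances, through the bijection [CodeSeq.code] from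
    [seq nat] to [nat] *)

Notation code := CodeSeq.code.

Definition code_pair (e : nat * nat) : nat := code [:: e.1; e.2].

Definition code_packet (p : rpacket) : nat :=
  let: (s, d, t) := p in code [:: s; d; t].

Definition code_send (a : nat * rpacket) : nat :=
  code [:: a.1; code_packet a.2].

Definition code_output (b : rpacket * nat) : nat :=
  code [:: code_packet b.1; b.2].

Definition code_rule (r : rule) : nat :=
  code [:: r_src r; code_packet (r_packet r); r_port r;
           code (map code_output (r_out r)); r_dst r].

Definition code_mbox (d : mbox_desc) : nat :=
  code [:: md_last d; code (map code_rule (md_rules d))].

Definition code_instance (x : instance) : nat :=
  code [:: i_hosts x; i_tags x; code (map code_pair (i_edges x));
           code (map code_send (i_sends x)); code (map code_mbox (i_mboxes x));
           code (i_Hi x); code (map code_packet (i_Pi x))].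

Lemma code_inj : injective code.
Proof. exact: can_inj CodeSeq.codeK. Qed.

Lemma code_packet_inj : injective code_packet.
Proof. by move=> [[s d] t] [[s' d'] t'] /code_inj [-> -> ->]. Qed.

Lemma code_pair_inj : injective code_pair.
Proof. by move=> [a b] [a' b'] /code_inj [-> ->]. Qed.

Lemma code_send_inj : injective code_send.
Proof. by move=> [a b] [a' b'] /code_inj [-> /code_packet_inj ->]. Qed.

Lemma code_output_inj : injective code_output.
Proof. by move=> [a b] [a' b'] /code_inj [/code_packet_inj -> ->]. Qed.

Lemma code_rule_inj : injective code_rule.
Proof.
move=> [q p i o q'] [? ? ? ? ?] /code_inj /=.
by move=> [-> /code_packet_inj -> -> /code_inj/(inj_map code_output_inj) -> ->].
Qed.

Lemma code_mbox_inj : injective code_mbox.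
Proof.
by move=> [n s] [? ?] /code_inj /= [-> /code_inj/(inj_map code_rule_inj) ->].
Qed.

Lemma code_instance_inj : injective code_instance.
Proof.
move=> [h t e s m hi pi] [? ? ? ? ? ? ?] /code_inj /= [-> ->].
move=> /code_inj/(inj_map code_pair_inj) -> /code_inj/(inj_map code_send_inj) ->.
move=> /code_inj/(inj_map code_mbox_inj) -> /code_inj ->.
by move=> /code_inj/(inj_map code_packet_inj) ->.
Qed.

(* Main.v *)
Require Import Defs.
From HB Require Import structures.
From mathcomp Require Import all_boot zify.
From Stdlib Require Import FunctionalExtensionality.

Set Implicit Arguments.
Unset Strict Implicit.
Unset Printing Implicit Defensive.

(** A finite control with one FIFO queue is a network without forwarding loops:
    one host sends arbitrary packets to two adjacent middleboxes.  The first one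
    runs the control: it pushes a bit by forwarding a host packet to the second
    one, and pops a bit by receiving it from there.  The second one, the relay,
    remembers each bit that it receives and forwards a new host packet carrying
    the same bit, so that the queue survives although no id returns to a
    middlebox.  Wrong guesses of the host only abort a middlebox.

    Such a nondeterministic queue automaton keeps a multiset of registers in its
    queue and can check, by guessing all intermediate results, whether a partial
    recursive function takes a given value.

    The input [n] is loaded by a chain of [n] transitions placed in front of the
    rules, so the code of the instance for the rules coded by [e] and the input
    [e] is a recursive function [rdiag] of [e].  If [f] decided isolation, the
    rules checking whether [f (rdiag n) = 1], run on their own code, would yield
    an instance isolated iff [f] does not say so. *)

(** * Reflexive transitive closures *)

Inductive star S (R : S -> S -> Prop) (x : S) : S -> Prop :=
| star_refl : star R x x
| star_step y z : R x y -> star R y z -> star R x z.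

Lemma star_one S (R : S -> S -> Prop) x y : R x y -> star R x y.
Proof. by move=> xy; apply: star_step xy (star_refl _ _). Qed.

Lemma star_trans S (R : S -> S -> Prop) y x z :
  star R x y -> star R y z -> star R x z.
Proof.
by move=> xy yz; elim: xy yz => // {}x u v xu _ IH /IH; apply: star_step.
Qed.

(** * Regular programs *)

Inductive prog A :=
| Skip
| Atom of A
| Seq of prog A & prog A
| Alt of prog A & prog A
| Star of prog A.

Arguments Skip {A}.

Infix ">>" := Seq (at level 61, right associativity).

Lemma prog_comparable (A : eqType) : comparable (prog A).
Proof. by rewrite /comparable /decidable; decide equality; apply: eq_comparable. Qed.

HB.instance Definition _ (A : eqType) :=
  hasDecEq.Build (prog A) (compareP (@prog_comparable A)).

Section Sem.

Variables (A S : Type) (act : A -> S -> S -> Prop).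

(** The meaning of the atoms is a parameter because programs act both on queues and, later, on
    register stores. *)
Fixpoint sem (p : prog A) (s s' : S) : Prop :=
  match p with
  | Skip => s' = s
  | Atom a => act a s s'
  | Seq p q => exists t, sem p s t /\ sem q t s'
  | Alt p q => sem p s s' \/ sem q s s'
  | Star p => star (sem p) s s'
  end.

End Sem.

(** * Queue automata *)

Inductive qact := Push of bool | Pop of bool.

Inductive label := Eps | Act of qact | Halt.

Lemma qact_comparable : comparable qact.
Proof. by rewrite /comparable /decidable; decide equality; apply: eq_comparable. Qed.

HB.instance Definition _ := hasDecEq.Build qact (compareP qact_comparable).

Lemma label_comparable : comparable label.
Proof. by rewrite /comparable /decidable; decide equality; apply: eq_comparable. Qed.

HB.instance Definition _ := hasDecEq.Build label (compareP label_comparable).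

Definition edge := (nat * label * nat)%type.

Definition qsem (a : qact) (w w' : seq bool) : Prop :=
  match a with
  | Push b => w' = rcons w b
  | Pop b => w = b :: w'
  end.

Definition lsem (l : label) (w w' : seq bool) : Prop :=
  if l is Act a then qsem a w w' else w' = w.

Definition astep (E : seq edge) (c c' : nat * seq bool) : Prop :=
  exists2 l, (c.1, l, c'.1) \in E & lsem l c.2 c'.2.

Definition accepts (E : seq edge) : Prop :=
  exists c q', star (astep E) (0, [::]) c /\ (c.1, Halt, q') \in E.

(** * Small-step execution with continuations *)

Notation cont := (seq (prog qact)).

Definition succs (k : cont) : seq (label * cont) :=
  match k with
  | [::] => [::]
  | Skip :: k => [:: (Eps, k)]
  | Atom a :: k => [:: (Act a, k)]
  | Seq p q :: k => [:: (Eps, p :: q :: k)]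
  | Alt p q :: k => [:: (Eps, p :: k); (Eps, q :: k)]
  | Star p :: k => [:: (Eps, k); (Eps, p :: Star p :: k)]
  end.

Definition cstep (c c' : cont * seq bool) : Prop :=
  exists2 l, (l, c'.1) \in succs c.1 & lsem l c.2 c'.2.

Fixpoint csem (k : cont) (w w' : seq bool) : Prop :=
  if k is p :: k then exists v, sem qsem p w v /\ csem k v w' else w' = w.

(** Big-step behaviour is propagated backwards along a step, so a small-step run that ends in [[::]]
    yields a big-step execution. *)
Lemma cstep_csem c c' w : cstep c c' -> csem c'.1 c'.2 w -> csem c.1 c.2 w.
Proof.
case: c c' => [k v] [k' v'] [l] /=.
case: k => [|[|a|p q|p q|p] k] //=; rewrite ?inE.
- by move=> /eqP [-> ->] /= ->; exists v.
- by move=> /eqP [-> ->] /= ? ?; exists v'.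
- move=> /eqP [-> ->] /= -> [u [pu [t [qt kt]]]].
  by exists t; split=> //; exists u.
- by case/orP=> /eqP [-> ->] /= -> [u [pu ku]]; exists u; split; auto.
- case/orP=> /eqP [-> ->] /= ->; first by exists v; split=> //; constructor.
  case=> [u [pu [t [pt kt]]]]; exists t; split=> //.
  by apply: star_step pu pt.
Qed.

Lemma star_csem c c' : star cstep c c' -> c'.1 = [::] -> csem c.1 c.2 c'.2.
Proof.
elim=> [{}c -> //|x y z xy _ IH /IH]; exact: cstep_csem.
Qed.

Lemma sem_star p w w' :
  sem qsem p w w' -> forall k, star cstep (p :: k, w) (k, w').
Proof.
elim: p w w' => [|a|p IHp q IHq|p IHp q IHq|p IHp] w w' /=.
- by move=> -> k; apply: star_one; exists Eps; rewrite //= inE.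
- by move=> aw k; apply: star_one; exists (Act a); rewrite //= inE.
- move=> [v [pv qv]] k; apply: (@star_step _ _ _ (p :: q :: k, w)).
    by exists Eps; rewrite //= inE.
  by apply: star_trans (IHp _ _ pv _) (IHq _ _ qv _).
- case=> [/IHp|/IHq] IH k; [apply: (@star_step _ _ _ (p :: k, w)) (IH k)|
    apply: (@star_step _ _ _ (q :: k, w)) (IH k)];
    by exists Eps; rewrite //= !inE eqxx ?orbT.
- elim=> [{}w|{}w v {}w' pv _ IH] k.
    by apply: star_one; exists Eps; rewrite //= inE eqxx.
  apply: (@star_step _ _ _ (p :: Star p :: k, w)).
    by exists Eps; rewrite //= !inE eqxx orbT.
  by apply: star_trans (IHp _ _ pv _) (IH k).
Qed.

(** The list is finite because the body of a [Star] runs on top of [p :: k] itself, so each round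
    returns to a listed continuation. These continuations play the role of the partial derivatives
    of a regular expression. *)
Fixpoint conts (p : prog qact) (k : cont) : seq cont :=
  (p :: k) ::
  match p with
  | Seq p1 p2 => conts p1 (p2 :: k) ++ conts p2 k
  | Alt p1 p2 => conts p1 k ++ conts p2 k
  | Star p1 => conts p1 (p :: k)
  | _ => [::]
  end.

Lemma head_conts p k : p :: k \in conts p k.
Proof. by case: p => *; rewrite inE eqxx. Qed.

(** A subprogram that finishes exposes the continuation it was started on, which is either [k] or
    again in the list; hence the induction on [p] is for all [k]. *)
Lemma conts_closed p k c l c' :
  c \in conts p k -> (l, c') \in succs c -> c' = k \/ c' \in conts p k.
Proof.
elim: p k => [|a|p IHp q IHq|p IHp q IHq|p IHp] k /=; rewrite !inE.
- by move=> /eqP -> /=; rewrite inE => /eqP [_ ->]; left.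
- by move=> /eqP -> /=; rewrite inE => /eqP [_ ->]; left.
- rewrite !mem_cat => /orP[/eqP->|/orP[cp|cq]] /=.
  + by rewrite inE => /eqP [_ ->]; right; rewrite head_conts orbT.
  + case/(IHp _ cp) => [->|->]; first by right; rewrite head_conts !orbT.
    by right; rewrite orbT.
  + by case/(IHq _ cq) => [->|->]; [left|right; rewrite !orbT].
- rewrite !mem_cat => /orP[/eqP->|/orP[cp|cq]] /=.
  + by rewrite !inE => /orP[]/eqP [_ ->]; right; rewrite head_conts !orbT.
  + by case/(IHp _ cp) => [->|->]; [left|right; rewrite !orbT].
  + by case/(IHq _ cq) => [->|->]; [left|right; rewrite !orbT].
- move=> /orP[/eqP->|cp] /=.
  + rewrite !inE => /orP[]/eqP [_ ->]; first by left.
    by right; rewrite head_conts !orbT.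
  + by case/(IHp _ cp) => [->|->]; right; rewrite ?eqxx ?orbT.
Qed.

Section ProgramAutomaton.

Variable p : prog qact.

Definition states : seq cont := rcons (conts p [::]) [::].

(** Odd numbers leave the even ones free for loading the input. As [[:: p]] heads the list of
    states, the program starts in state 1. *)
Definition num (k : cont) : nat := (index k states).*2.+1.

Definition prog_edges : seq edge :=
  (num [::], Halt, num [::]) ::
  [seq (num k, x.1, num x.2) | k <- states, x <- succs k].

Lemma states_closed k l k' : k \in states -> (l, k') \in succs k -> k' \in states.
Proof.
rewrite !mem_rcons !inE => /orP[/eqP -> //|ks ksk'].
by case: (conts_closed ks ksk') => ->; rewrite ?eqxx ?orbT.
Qed.

Lemma num_inj : {in states &, injective num}.
Proof.
move=> k k' ks ks' /eqP; rewrite eqSS => /eqP /double_inj eqi.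
by rewrite -(nth_index [::] ks) eqi nth_index.
Qed.

Lemma prog_edgesP q l q' : (q, l, q') \in prog_edges ->
  (l = Halt /\ q = num [::]) \/
  exists k k', [/\ k \in states, (l, k') \in succs k, q = num k & q' = num k'].
Proof.
rewrite inE => /orP[/eqP[-> -> _]|]; first by left.
case/allpairsPdep => k [[l' k'] [ks kk' [-> -> ->]]].
by right; exists k, k'.
Qed.

Lemma succs_noHalt k k' : (Halt, k') \notin succs k.
Proof.
case: k => [|[|a|p1 p2|p1 p2|p1] k] //=; rewrite !inE ?negb_or.
all: by do ?[apply/andP; split]; apply/eqP => -[].
Qed.

Lemma num_start : num [:: p] = 1.
Proof. by rewrite /num /states; case: (p) => * /=; rewrite eqxx. Qed.

Lemma start_states : [:: p] \in states.
Proof. by rewrite mem_rcons inE head_conts orbT. Qed.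

Lemma nil_states : [::] \in states.
Proof. by rewrite mem_rcons inE eqxx. Qed.

End ProgramAutomaton.

(** * Loading the input in unary *)

Fixpoint load n (E : seq edge) : seq edge :=
  if n is n'.+1 then (n'.*2, Act (Push false), n.*2) :: load n' E else E.

(** The chain is consed edge by edge in front of the rules, so that the code of the result is
    primitive recursive in [n] and the code of [E]. *)
Definition input n (E : seq edge) : seq edge := (n.*2, Eps, 1) :: load n E.

Lemma loadP n E q l q' : (q, l, q') \in load n E <->
  (exists k, [/\ k < n, q = k.*2, l = Act (Push false) & q' = k.+1.*2])
  \/ (q, l, q') \in E.
Proof.
elim: n q l q' => [|n IH] q l q' /=; first by split=> [|[[k []]|]] //; right.
rewrite inE; split.
  case/orP=> [/eqP[-> -> ->]|/IH [[k [kn -> -> ->]]|]]; last by right.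
    by left; exists n.
  by left; exists k; split=> //; apply: ltnW.
case=> [[k [kn -> -> ->]]|qE]; apply/orP; last by right; apply/IH; right.
move: kn; rewrite ltnS leq_eqVlt => /orP[/eqP->|kn]; first by left.
by right; apply/IH; left; exists k.
Qed.

Lemma rcons_nseq T n (x : T) : rcons (nseq n x) x = nseq n.+1 x.
Proof. by elim: n => //= n ->. Qed.

(* Even states belong to the loading chain, odd ones to the program. *)
Lemma accepts_input p n :
  accepts (input n (prog_edges p)) <-> exists w, sem qsem p (nseq n false) w.
Proof.
set E := input n _.
have inE_ q l q' : (q, l, q') \in prog_edges p -> (q, l, q') \in E.
  by move=> ?; rewrite inE; apply/orP; right; apply/loadP; right.
split.
  (* Either loading is under way, with [k] bits pushed in state [k.*2], or the program runs and has
     reached the continuation [k] from the fully loaded queue. *)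
  pose inv (c : nat * seq bool) :=
    (exists2 k, k <= n & c = (k.*2, nseq k false)) \/
    exists k, [/\ k \in states p, c.1 = num p k
                & star cstep ([:: p], nseq n false) (k, c.2)].
  have inv_step c c' : astep E c c' -> inv c -> inv c'.
    case: c c' => [q w] [q' w'] [l] /=; rewrite inE => Ec cc'.
    case/orP: Ec => [/eqP[eq1 eq2 eq3]|/loadP[[k [kn eq1 eq2 eq3]]|qE]]; subst.
    - case=> [[k kn [/double_inj ? ?]]|]; last first.
        by case=> k [_ /= eqn _]; exfalso; move: eqn; rewrite /num; lia.
      subst k w; right; exists [:: p].
      by rewrite num_start start_states cc'; split=> //; constructor.
    - case=> [[k' kn' [/double_inj ? ?]]|]; last first.
        by case=> k' [_ /= eqn _]; exfalso; move: eqn; rewrite /num; lia.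
      subst k' w; left; exists k.+1 => //; rewrite cc'.
      by rewrite rcons_nseq.
    - case/prog_edgesP: (qE) => [[? ?]|[k [k' [ks kk' ? ?]]]]; subst.
        case=> [[k kn [eqn _]]|[k [ks /= /num_inj eqk cw]]].
          by exfalso; rewrite /num in eqn; lia.
        (* Only the self-loop at [num [::]] carries [Halt], so taking it changes neither the state
           nor the queue. *)
        move: qE; rewrite inE => /orP[/eqP [->]|]; last first.
          case/allpairsPdep => k' [[l' k''] [_ kk' [_ eql _]]].
          by move: kk'; rewrite -eql (negPf (succs_noHalt _ _)).
        right; exists [::]; rewrite nil_states; split=> //=.
        by rewrite cc'; rewrite -eqk ?nil_states // in cw.
      case=> [[j jn [eqn _]]|[j [js /= /num_inj eqk cw]]].
        by exfalso; rewrite /num in eqn; lia.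
      right; exists k'; split=> //=; first exact: states_closed kk'.
      rewrite -eqk // in cw; apply: star_trans cw _; apply: star_one.
      by exists l.
  have inv_star c : star (astep E) (0, [::]) c -> inv c.
    have: inv (0, [::]) by left; exists 0.
    by move=> + sc; elim: sc => // x y z xy _ IH /(inv_step _ _ xy).
  case=> [[q w] [q' [/inv_star invc /= qE]]].
  move: qE; rewrite inE => /orP[/eqP[]//|].
  case/loadP=> [[k []]//|/prog_edgesP[[_ eqq]|[k [k' [_]]]]]; last first.
    by rewrite (negPf (succs_noHalt _ _)).
  subst q; case: invc => [[k kn [eqn _]]|[k [ks /= /num_inj eqk cw]]].
    by exfalso; rewrite /num in eqn; lia.
  rewrite -eqk ?nil_states // in cw; exists w.
  by have [v [pv /= ->]] := star_csem cw erefl.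
case=> w /sem_star /(_ [::]) pw.
have loads k : k <= n -> star (astep E) (0, [::]) (k.*2, nseq k false).
  elim: k => [|k IH] kn; first exact: star_refl.
  apply: star_trans (IH (ltnW kn)) _; apply: star_one.
  exists (Act (Push false)); last by rewrite /= rcons_nseq.
  by rewrite inE; apply/orP; right; apply/loadP; left; exists k.
exists (num p [::], w), (num p [::]); split; last first.
  by apply: inE_; rewrite inE eqxx.
apply: star_trans (loads n (leqnn n)) _.
apply: (@star_step _ _ _ (num p [:: p], nseq n false)).
  by exists Eps; rewrite //= num_start inE eqxx.
have st c c' : star cstep c c' -> c.1 \in states p ->
    star (astep E) (num p c.1, c.2) (num p c'.1, c'.2).
  elim=> [{}c|x y z [l xy lxy] _ IH] xs; first exact: star_refl.
  have ys := states_closed xs xy.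
  apply: star_step (IH ys); exists l => //=; apply: inE_; rewrite inE.
  apply/orP; right; apply/allpairsPdep.
  by exists x.1, (l, y.1).
exact: st pw (start_states p).
Qed.

(** * Instances of the isolation problem *)

Section InstanceFacts.

Variable x : instance.
Local Notation N := (inst_net x).

Lemma node_num_inj : injective (@node_num x).
Proof.
move=> [h|m] [h'|m'] /= eqn.
- by congr inl; apply: val_inj.
- by have := ltn_ord h; rewrite eqn ltnNge leq_addr.
- by have := ltn_ord h'; rewrite -eqn ltnNge leq_addr.
- by congr inr; apply: val_inj; apply: addnI eqn.
Qed.

Lemma packet_num_inj : injective (@packet_num x).
Proof.
move=> [[s d] t] [[s' d'] t'] [] es ed et.
by rewrite (val_inj es) (val_inj ed) (val_inj et).
Qed.

Definition out_num (m : mbox N) (b : packet N * port m) : rpacket * nat :=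
  (packet_num b.1, node_num (val b.2)).

Lemma out_num_inj m : injective (@out_num m).
Proof. by move=> [p v] [p' v'] [/packet_num_inj -> /node_num_inj /val_inj ->]. Qed.

(** Rules list their outputs by numbers. Since the numbering is injective, a one-element list
    denotes a singleton, which has a single enumeration; so the order of emission leaves no choice
    for the rules used here. *)
Lemma enum_out1 m (b : packet N * port m) :
  enum [set b' | out_num b' \in [:: out_num b]] = [:: b].
Proof.
have -> : [set b' | out_num b' \in [:: out_num b]] = [set b].
  by apply/setP=> b'; rewrite !inE (inj_eq (@out_num_inj m)).
exact: enum_set1.
Qed.

Lemma enum_out0 m :
  enum [set b' : packet N * port m | out_num b' \in [::]] = [::].
Proof.
have -> : [set b' : packet N * port m | out_num b' \in [::]] = set0.
  by apply/setP=> b'; rewrite !inE.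
exact: enum_set0.
Qed.

Lemma perm_out1 m (b : packet N * port m) (s : seq (packet N * port m)) :
  perm_eq s (enum [set b' | out_num b' \in [:: out_num b]]) -> s = [:: b].
Proof. by rewrite enum_out1 => sb; apply: perm_small_eq. Qed.

Lemma perm_out0 m (s : seq (packet N * port m)) :
  perm_eq s (enum [set b' | out_num b' \in [::]]) -> s = [::].
Proof. by rewrite enum_out0; apply/perm_nilP. Qed.

(** Plain numbers replace the dependently typed states, so that states of different middleboxes can
    be treated uniformly; [None] still stands for abort. *)
Definition st X (c : config N X) (m : mbox N) : option nat :=
  omap val (mstate c m).

Lemma st_dfwith X (c : config N X) ch m (y : option (state m)) m' :
  st (Config ch (dfwith (mstate c) y) : config N X) m' =
  if m' == m then omap val y else st c m'.
Proof.
rewrite /st /=; case: eqVneq => [->|mm']; first by rewrite dfwith_in.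
by rewrite dfwith_out // eq_sym.
Qed.

Lemma fire c m (v : port m) p r q q' o :
  reachable c -> st c m = Some q -> chan c (val v) (inr m) = p :: r ->
  (forall s s' : state m, val s = q -> val s' = q' -> delta s (p, v) o s') ->
  q' <= md_last (inst_mbox m) ->
  exists c' : config N (packet N),
  [/\ reachable c',
      chan c' = emit (enum o) (pop (chan c) (val v) (inr m))
    & forall m', st c' m' = if m' == m then Some q' else st c m'].
Proof.
move=> rc; rewrite /st; case mq: (mstate c m) => [s|//] [eqs] cp dl q'L.
pose s' : state m := Ordinal (q'L : q' < (md_last (inst_mbox m)).+1).
exists (Config (emit (enum o) (pop (chan c) (val v) (inr m)))
               (dfwith (mstate c) (Some s'))).
split=> // [|m']; last by rewrite -/(st _ _) st_dfwith.
apply: ReachStep rc _; apply: MboxStep mq cp (dl s s' _ _) _ => //.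
Qed.

End InstanceFacts.

(** * The network of a queue automaton *)

Definition pkt (t : nat) : rpacket := (0, 0, t).

(** Node 0 is the host, 1 the control and 2 the relay; tags 0 and 1 are bits. A middlebox moves only
    on reception, so [Eps] and [Halt] consume a host packet with the auxiliary tag 2, which [Halt]
    sends back to the host as the forbidden packet. *)
Definition rule_of (e : edge) : rule :=
  let: (q, l, q') := e in
  match l with
  | Eps => Rule q (pkt 2) 0 [::] q'
  | Act (Push b) => Rule q (pkt b) 0 [:: (pkt b, 2)] q'
  | Act (Pop b) => Rule q (pkt b) 2 [::] q'
  | Halt => Rule q (pkt 2) 0 [:: (pkt 2, 0)] q'
  end.

(** State 0 is empty-handed and state [b.+1] holds the bit [b], which only a host packet with the
    same tag can release. *)
Definition relay : mbox_desc :=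
  MboxDesc 2 [:: Rule 0 (pkt 0) 1 [::] 1; Rule 1 (pkt 0) 0 [:: (pkt 0, 1)] 0;
                 Rule 0 (pkt 1) 1 [::] 2; Rule 2 (pkt 1) 0 [:: (pkt 1, 1)] 0].

Definition qinst (L : nat) (R : seq rule) : instance :=
  Instance 1 3 [:: (0, 1); (0, 2); (1, 2)]
    [:: (0, pkt 0); (0, pkt 1); (0, pkt 2)]
    [:: MboxDesc L R; relay] [:: 0] [:: pkt 2].

Section QueueNetwork.

Variables (L : nat) (E : seq edge).
Local Notation x := (qinst L (map rule_of E)).
Local Notation N := (inst_net x).

Definition mB : mbox N := @Ordinal 2 0 isT.
Definition mC : mbox N := @Ordinal 2 1 isT.
Definition nh : node N := inl (@Ordinal 1 0 isT).
Definition nB : node N := inr mB.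
Definition nC : node N := inr mC.

Lemma mboxE (m : mbox N) : m = mB \/ m = mC.
Proof. by case: m => [[|[|//]] ?]; [left|right]; apply: val_inj. Qed.

Lemma nodeE (v : node N) : [\/ v = nh, v = nB | v = nC].
Proof.
case: v => [h|m]; last by case: (mboxE m) => ->; [constructor 2|constructor 3].
by constructor 1; congr inl; apply: val_inj; case: h => [[]].
Qed.

Definition node_eqs :=
  (eqxx nh, eqxx nB, eqxx nC,
   (erefl : (nh == nB) = false), (erefl : (nh == nC) = false),
   (erefl : (nB == nh) = false), (erefl : (nB == nC) = false),
   (erefl : (nC == nh) = false), (erefl : (nC == nB) = false),
   (erefl : (mC == mB) = false), (erefl : (mB == mC) = false),
   eqxx mB, eqxx mC).

Definition pk (t : 'I_3) : packet N := (@Ordinal 1 0 isT, @Ordinal 1 0 isT, t).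
Definition tagb (b : bool) : 'I_3 :=
  if b then @Ordinal 3 1 isT else @Ordinal 3 0 isT.
Definition pkb (b : bool) : packet N := pk (tagb b).
Definition pke : packet N := pk (@Ordinal 3 2 isT).

Lemma pkb_num b : packet_num (pkb b) = pkt b.
Proof. by case: b. Qed.

Lemma pke_num : packet_num pke = pkt 2.
Proof. by []. Qed.

Lemma pkbP p (b : bool) : pkt b = @packet_num x p -> p = pkb b.
Proof. by rewrite -pkb_num => /packet_num_inj. Qed.

Lemma pkeP p : pkt 2 = @packet_num x p -> p = pke.
Proof. by rewrite -pke_num => /packet_num_inj. Qed.

Definition portBh : port mB := exist _ nh isT.
Definition portBC : port mB := exist _ nC isT.
Definition portCh : port mC := exist _ nh isT.
Definition portCB : port mC := exist _ nB isT.

Lemma portBE (v : port mB) : v = portBh \/ v = portBC.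
Proof.
by case: v => v a; case: (nodeE v) a => -> // a; [left|right]; apply: val_inj.
Qed.

Lemma portCE (v : port mC) : v = portCh \/ v = portCB.
Proof.
by case: v => v a; case: (nodeE v) a => -> // a; [left|right]; apply: val_inj.
Qed.

Lemma outBC (b : bool) : (pkt b, 2) = out_num (pkb b, portBC).
Proof. by case: b. Qed.
Lemma outBh : (pkt 2, 0) = out_num (pke, portBh).
Proof. by []. Qed.
Lemma outCB (b : bool) : (pkt b, 1) = out_num (pkb b, portCB).
Proof. by case: b. Qed.

(** Inversion of the numeric rules: transitions of the control in terms of automaton edges, with the
    output as the list that is actually emitted. *)
Variant tranB (q : nat) (p : packet N) (v : port mB) (q' : nat) :
    seq (packet N * port mB) -> Prop :=
| TranEps : (q, Eps, q') \in E -> p = pke -> v = portBh ->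
    tranB q p v q' [::]
| TranPush b : (q, Act (Push b), q') \in E -> p = pkb b -> v = portBh ->
    tranB q p v q' [:: (pkb b, portBC)]
| TranPop b : (q, Act (Pop b), q') \in E -> p = pkb b -> v = portBC ->
    tranB q p v q' [::]
| TranHalt : (q, Halt, q') \in E -> p = pke -> v = portBh ->
    tranB q p v q' [:: (pke, portBh)].

Lemma deltaB (q q' : state mB) p v o s :
  delta q (p, v) o q' -> perm_eq s (enum o) ->
  tranB (val q) p v (val q') s.
Proof.
rewrite /= /inst_delta has_map => /hasP [[[q1 l] q2] eE] /=.
case: l eE => [|[] b|] eE /= /and5P[/eqP eq1 /eqP ep /eqP ev /eqP -> /eqP eq2];
  rewrite eq1 eq2 in eE.
- move=> /(@perm_out0 x mB) ->; apply: TranEps => //; first exact: pkeP.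
  by case: (portBE v) ev => ->.
- rewrite outBC => /(@perm_out1 x mB) ->; apply: TranPush => //; first exact: pkbP.
  by case: (portBE v) ev => ->.
- move=> /(@perm_out0 x mB) ->; apply: (TranPop eE); first exact: pkbP.
  by case: (portBE v) ev => ->.
- rewrite outBh => /(@perm_out1 x mB) ->; apply: TranHalt => //; first exact: pkeP.
  by case: (portBE v) ev => ->.
Qed.

Variant tranC (q : nat) (p : packet N) (v : port mC) (q' : nat) :
    seq (packet N * port mC) -> Prop :=
| TranStore (b : bool) : q = 0 -> q' = b.+1 -> p = pkb b -> v = portCB ->
    tranC q p v q' [::]
| TranRelay (b : bool) : q = b.+1 -> q' = 0 -> p = pkb b -> v = portCh ->
    tranC q p v q' [:: (pkb b, portCB)].

Lemma deltaC (q q' : state mC) p v o s :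
  delta q (p, v) o q' -> perm_eq s (enum o) ->
  tranC (val q) p v (val q') s.
Proof.
rewrite /= /inst_delta /= => H.
case/or4P: H => [H|H|H|]; last (rewrite orbF => H);
  case/and5P: H => [/eqP <- /eqP ep /eqP ev /eqP -> /eqP <-].
- move=> /(@perm_out0 x mC) ->; apply: (@TranStore _ _ _ _ false) => //.
    exact: (@pkbP _ false).
  by case: (portCE v) ev => ->.
- rewrite (outCB false) => /(@perm_out1 x mC) ->; apply: (@TranRelay _ _ _ _ false) => //.
    exact: (@pkbP _ false).
  by case: (portCE v) ev => ->.
- move=> /(@perm_out0 x mC) ->; apply: (@TranStore _ _ _ _ true) => //.
    exact: (@pkbP _ true).
  by case: (portCE v) ev => ->.
- rewrite (outCB true) => /(@perm_out1 x mC) ->; apply: (@TranRelay _ _ _ _ true) => //.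
    exact: (@pkbP _ true).
  by case: (portCE v) ev => ->.
Qed.


(** * Runs of the network follow the automaton *)

Definition pend (q : nat) : seq bool :=
  match q with 0 => [::] | 1 => [:: false] | _ => [:: true] end.

(* The queue is spread over the channel from the relay, the state of the relay
   and the channel to the relay.  Once the relay has aborted only the first of
   these parts is still usable, hence the unspecified rest [v]. *)
Definition simulates (c : config N (packet N)) : Prop :=
  exists u1 u2,
  [/\ chan c nB nC = map pkb u1, chan c nC nB = map pkb u2,
      chan c nC nh = [::] /\ chan c nh nh = [::],
      chan c nB nh != [::] -> accepts E
    & forall q, st c mB = Some q -> exists v,
        star (astep E) (0, [::]) (q, u2 ++ v) /\
        forall qc, st c mC = Some qc -> v = pend qc ++ u1].

(** Sends by the host only touch channels that the invariant ignores. Moves of the control are edges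
    of the automaton, and moves of the relay shift a bit between the three parts of an unchanged
    queue. An abort of the control voids the last clause; an abort of the relay merely detaches [v]
    from the channels. *)
Lemma reachable_simulates c : reachable c -> simulates c.
Proof.
elim=> [|{}c c' _ IH stp].
  exists [::], [::]; split=> // q [<-]; exists [::]; split; first exact: star_refl.
  by move=> qc [<-].
case: IH => u1 [u2 [c1 c2 [c3 c3'] c4 c5]].
case: stp c1 c2 c3 c3' c4 c5 => {c c'} [c h v p hv _|c m pr p r q o q' s mq cp dq so|
    c m pr p r q mq cp dq] c1 c2 c3 c3' c4 c5.
- have -> : inl h = nh by case: (nodeE (inl h)).
  have vh : (nh == v) = false.
    by apply/negP => /eqP vh; move: hv; rewrite -vh; case: h => [[]].
  by exists u1, u2; split; rewrite /= /append ?node_eqs //= vh.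
- have stc ch := st_dfwith c ch (Some q').
  case: (mboxE m) => ?; subst m.
  + have stq : st c mB = Some (val q) by rewrite /st mq.
    have [v [rch vC]] := c5 _ stq.
    case: (deltaB dq so) => {so dq} [e ? ?|b e ? ?|b e ? ?|e ? ?]; subst p pr.
    * exists u1, u2; split; rewrite /= /pop ?node_eqs // => q1.
      rewrite !stc ?node_eqs => -[<-]; exists v; split=> //.
      by apply: star_trans rch (star_one _); exists Eps.
    * exists (rcons u1 b), u2; split; rewrite /= /append /pop ?node_eqs //=.
        by rewrite c1 map_rcons.
      move=> q1; rewrite !stc ?node_eqs => -[<-]; exists (rcons v b).
      split; last by move=> qc /vC ->; rewrite rcons_cat.
      apply: star_trans rch (star_one _); exists (Act (Push b)) => //=.
      by rewrite rcons_cat.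
    * case: u2 c2 c5 rch => [|b' u2] c2 c5 rch; first by rewrite /= c2 in cp.
      have ?: b' = b by move: cp; rewrite /= c2 => -[]; case: (b'); case: (b).
      subst b'; exists u1, u2; split; rewrite /= /pop ?node_eqs ?c2 // => q1.
      rewrite !stc ?node_eqs => -[<-]; exists v; split=> //.
      by apply: star_trans rch (star_one _); exists (Act (Pop b)).
    * exists u1, u2; split; rewrite /= /append /pop ?node_eqs //=.
        by move=> _; exists (val q, u2 ++ v), (val q').
      move=> q1; rewrite !stc ?node_eqs => -[<-]; exists v; split=> //.
      by apply: star_trans rch (star_one _); exists Halt.
  + have stq : st c mC = Some (val q) by rewrite /st mq.
    case: (deltaC dq so) => {so dq} b eq eq' ? ?; subst p pr.
    * case: u1 c1 c5 => [|b' u1] c1 c5; first by rewrite /= c1 in cp.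
      have ?: b' = b by move: cp; rewrite /= c1 => -[]; case: (b'); case: (b).
      subst b'; exists u1, u2; split; rewrite /= /pop ?node_eqs ?c1 // => q1.
      rewrite !stc ?node_eqs => /c5 [v [rch vC]]; exists v; split=> // qc.
      by case=> <-; rewrite (vC _ stq) eq eq'; case: (b).
    (* The bit held by the relay moves to the end of [u2], and what remains behind it is [u1]. *)
    * exists u1, (rcons u2 b); split; rewrite /= /append /pop ?node_eqs //=.
        by rewrite c2 map_rcons.
      move=> q1; rewrite !stc ?node_eqs => /c5 [v [rch vC]].
      move: rch; rewrite (vC _ stq) eq => rch.
      exists u1; split=> [|qc [<-]]; last by rewrite eq'.
      by move: rch; case: (b) => /=; rewrite cat_rcons.
- have stc ch := st_dfwith c ch (None : option (state m)).
  case: (mboxE m) => ?; subst m.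
  + case: (portBE pr) => ?; subst pr.
      exists u1, u2; split; rewrite /= /pop ?node_eqs // => q1.
      by rewrite !stc ?node_eqs.
    (* The dropped bit is harmless: the control is now in the abort state, so no automaton
       configuration has to be exhibited. *)
    exists u1, (behead u2); split; rewrite /= /pop ?node_eqs //.
      by rewrite c2 behead_map.
    move=> q1; by rewrite !stc ?node_eqs.
  + case: (portCE pr) => ?; subst pr.
      exists u1, u2; split; rewrite /= /pop ?node_eqs // => q1.
      rewrite !stc ?node_eqs => /c5 [v [rch vC]].
      by exists v; split=> // qc; rewrite !stc ?node_eqs.
    exists (behead u1), u2; split; rewrite /= /pop ?node_eqs //.
      by rewrite c1 behead_map.
    move=> q1; rewrite !stc ?node_eqs => /c5 [v [rch vC]].
    by exists v; split=> // qc; rewrite !stc ?node_eqs.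
Qed.

(** The channels to the host from the relay and from the host itself stay empty, so a received
    packet lies on the channel from the control, which is nonempty only if the automaton accepts. *)
Lemma received_accepts :
  (exists c h p, [/\ reachable c, h \in inst_Hi x, p \in inst_Pi x & received c h p]) ->
  accepts E.
Proof.
move=> [c [h [p [/reachable_simulates [u1 [u2 [_ _ [c1 c2] c3 _]]] _ _ [u pu]]]]].
have hh : inl h = nh by case: (nodeE (inl h)).
move: pu; rewrite hh; case: (nodeE u) => ->; rewrite ?c1 ?c2 // => pu.
by apply: c3; case: (chan c nB nh) pu.
Qed.

(** * The network can follow every run of the automaton *)

Lemma feed c m (v : port m) p q q' o :
  val v = nh -> p \in [:: pkb false; pkb true; pke] ->
  reachable c -> st c m = Some q -> chan c nh (inr m) = [::] ->
  (forall s s' : state m, val s = q -> val s' = q' -> delta s (p, v) o s') ->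
  q' <= md_last (inst_mbox m) ->
  exists c' : config N (packet N),
  [/\ reachable c', chan c' = emit (enum o) (chan c)
    & forall m', st c' m' = if m' == m then Some q' else st c m'].
Proof.
move=> vh pp rc mq c0 dl q'L.
have sp : p \in sendable (@Ordinal 1 0 isT : host N).
  by rewrite inE; move: pp; rewrite !inE => /or3P[]/eqP->.
have rc1 : reachable (Config (append (chan c) nh (inr m) p) (mstate c)).
  by apply: ReachStep rc _; apply: HostStep sp; case: (mboxE m) => ->.
have [|c' [rc' ch' st']] := @fire x _ m v p [::] q q' o rc1 mq _ dl q'L.
  by rewrite vh /= /append !eqxx c0.
exists c'; split=> //; rewrite ch' vh /=.
(* The channel from the host was empty, so the packet just sent is the one consumed and popping it
   restores all channels. *)
suff -> : pop (append (chan c) nh (inr m) p) nh (inr m) = chan c by [].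
apply: functional_extensionality => a; apply: functional_extensionality => b.
rewrite /pop /append; case eqab: ((a == nh) && (b == inr m)) => //.
by case/andP: eqab => /eqP-> /eqP->; rewrite c0.
Qed.

Lemma deltaB_edge e (q q' : state mB) p v :
  e \in E -> val q = e.1.1 -> val q' = e.2 ->
  r_packet (rule_of e) = packet_num p ->
  r_port (rule_of e) = node_num (val v) ->
  delta q (p, v) [set b | out_num b \in r_out (rule_of e)] q'.
Proof.
move=> eE eq eq' ep ev; rewrite /= /inst_delta has_map; apply/hasP; exists e => //=.
case: e {eE} eq eq' ep ev => [[q1 l] q2] /= eq eq' ep ev.
have -> : r_src (rule_of (q1, l, q2)) = q by case: (l) => [|[]|] /=.
have -> : r_dst (rule_of (q1, l, q2)) = q' by case: (l) => [|[]|] /=.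
by rewrite !eqxx ep ev !eqxx.
Qed.

(** Canonical form of an automaton configuration: the relay is empty-handed and the whole queue
    waits in the channel from the relay to the control. *)
Definition idle (c : config N (packet N)) (q : nat) (w : seq bool) : Prop :=
  [/\ reachable c, st c mB = Some q /\ st c mC = Some 0,
      chan c nh nB = [::] /\ chan c nh nC = [::], chan c nB nC = [::]
    & chan c nC nB = map pkb w].

Hypothesis E_le_L : forall q l q', (q, l, q') \in E -> q' <= L.

(** Completes a push: the relay stores the bit, then the host supplies a packet with the same tag,
    which the relay forwards to the end of the queue. *)
Lemma push_relay c b q w :
  reachable c -> st c mB = Some q -> st c mC = Some 0 ->
  chan c nh nB = [::] -> chan c nh nC = [::] ->
  chan c nB nC = [:: pkb b] -> chan c nC nB = map pkb w ->
  exists c', idle c' q (rcons w b).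
Proof.
move=> rc qB qC c1 c2 c3 c4.
have [||c' [rc' ch' st']] := @fire x _ mC portCB (pkb b) [::] 0 b.+1
    [set b' | out_num b' \in [::]] rc qC c3.
- move=> s s' es es'; rewrite /= /inst_delta /=.
  move: es es' => /= -> ->; rewrite /out_num.
  by case: (b); rewrite !eqxx //= ?orbT.
- by case: (b).
rewrite enum_out0 in ch'.
have [|||||c'' [rc'' ch'' st'']] := @feed c' mC portCh (pkb b) b.+1 0
    [set b' | out_num b' \in [:: out_num (pkb b, portCB)]] erefl _ rc'.
- by case: (b); rewrite !inE eqxx ?orbT.
- by rewrite st' eqxx.
- by rewrite ch' /= /pop !node_eqs.
- move=> s s' es es'; rewrite -outCB /= /inst_delta /=.
  move: es es' => /= -> ->; rewrite /out_num.
  by case: (b); rewrite !eqxx //= ?orbT.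
- by [].
exists c''; split=> //; rewrite ?st'' ?st' ?ch'' ?enum_out1 ?ch' /= /append /pop ?node_eqs //=.
  by rewrite c3.
by rewrite c4 map_rcons.
Qed.

Lemma idle_step c q w q' w' :
  astep E (q, w) (q', w') -> idle c q w -> exists c', idle c' q' w'.
Proof.
case=> l /= eE lw [rc [qB qC] [c1 c2] c3 c4].
have q'L := E_le_L eE.
have hs (p : packet N) (o : {set packet N * port mB}) e : e = (q, l, q') -> p \in [:: pkb false; pkb true; pke] ->
    r_packet (rule_of e) = packet_num p -> r_port (rule_of e) = 0 ->
    o = [set b | out_num b \in r_out (rule_of e)] ->
    exists c' : config N (packet N), [/\ reachable c', chan c' = emit (enum o) (chan c)
      & forall m', st c' m' = if m' == mB then Some q' else st c m'].
  move=> ee pp ep ev ->; apply: (@feed c mB portBh p q q' _ erefl pp rc qB c1 _ q'L).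
  by move=> s s' es es'; apply: deltaB_edge => //; rewrite ee.
case: l lw eE hs => [|[] b|] /= lw eE hs.
- have [|//|//|c' [rc' ch' st']] := hs pke _ _ erefl _ _ _ erefl.
    by rewrite !inE eqxx !orbT.
  exists c'; move: ch'; rewrite enum_out0 lw => ch'.
  by split; rewrite ?ch' ?st' ?node_eqs.
- have [||//|c' [rc' ch' st']] := hs (pkb b) _ _ erefl _ _ _ erefl.
  + by case: (b); rewrite !inE eqxx ?orbT.
  + by rewrite pkb_num.
  move: ch'; rewrite /= outBC enum_out1 lw => ch'.
  by apply: (@push_relay c'); rewrite ?ch' ?st' //= /append ?node_eqs //= c3.
(* A pop is the only move of the control triggered by the relay, so it needs no packet from the
   host. *)
- have [||c' [rc' ch' st']] := @fire x c mB portBC (pkb b) (map pkb w') q q'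
    [set b' | out_num b' \in [::]] rc qB _ _ q'L.
  + by rewrite c4 lw.
  + move=> s s' es es'.
    by apply: (@deltaB_edge (q, Act (Pop b), q')) => //; rewrite pkb_num.
  exists c'; move: ch'; rewrite enum_out0 => ch'.
  by split; rewrite ?ch' ?st' /= /pop ?node_eqs // c4 lw.
- have [|//|//|c' [rc' ch' st']] := hs pke _ _ erefl _ _ _ erefl.
    by rewrite !inE eqxx !orbT.
  exists c'; move: ch'; rewrite /= outBh enum_out1 lw => ch'.
  by split; rewrite ?ch' ?st' /= /append ?node_eqs.
Qed.

Lemma accepts_received : accepts E ->
  exists c h p, [/\ reachable c, h \in inst_Hi x, p \in inst_Pi x & received c h p].
Proof.
case=> [[q w] [q' [rch qq']]].
pose P (z : nat * seq bool) := exists c, idle c z.1 z.2.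
have idle_star z : star (astep E) (0, [::]) z -> P z.
  have ex0 : P (0, [::]) by exists initial; split=> //; apply: ReachInit.
  move=> sz; elim: sz ex0 => // -[q1 w1] [q2 w2] {}z s12 _ IH [c cq].
  exact/IH/(idle_step s12 cq).
have [c [rc [qB qC] [c1 c2] c3 c4]] := idle_star _ rch.
have [|||c' [rc' ch' st']] := @feed c mB portBh pke q q'
    [set b | out_num b \in r_out (rule_of (q, Halt, q'))] erefl _ rc qB c1 _ _.
- by rewrite !inE eqxx !orbT.
- by move=> s s' es es'; apply: deltaB_edge.
- exact: E_le_L qq'.
exists c', (@Ordinal 1 0 isT : host N), pke; split=> //.
- by rewrite inE.
- by rewrite inE.
exists nB; move: ch'; rewrite /= outBh enum_out1 => ->.
by rewrite /= /append ?node_eqs /= mem_rcons inE eqxx.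
Qed.

(** * Absence of forwarding loops *)

Definition occ (i : nat) (s : seq (nat * packet N)) : nat :=
  count (fun y => y.1 == i) s.

Lemma occ_cons i j p s : occ i ((j, p) :: s) = (j == i) + occ i s.
Proof. by []. Qed.

Lemma occ_rcons i j p s : occ i (rcons s (j, p)) = occ i s + (j == i).
Proof. by rewrite /occ -cats1 count_cat /= addn0. Qed.

Definition hits (m : mbox N) (i : nat) (rcv : seq (mbox N * nat)) : nat :=
  count_mem (m, i) rcv.

Lemma hits_cons m i m' j rcv :
  hits m i ((m', j) :: rcv) = (m' == m) && (j == i) + hits m i rcv.
Proof. by []. Qed.

(* Counts the past receptions of the id by [m] and bounds the future ones: a
   packet sent to the other middlebox [m'] may still be forwarded to [m]. *)
Definition visits (rcv : seq (mbox N * nat)) (c : config N (nat * packet N))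
    (i : nat) (m m' : mbox N) : nat :=
  hits m i rcv + occ i (chan c nh (inr m))
  + occ i (chan c (inr m') (inr m)) + occ i (chan c nh (inr m')).

Definition val_ports :=
  ((erefl : val portBh = nh), (erefl : val portBC = nC),
   (erefl : val portCh = nh), (erefl : val portCB = nB)).

Lemma chan_config X ch ms : chan (Config ch ms : config N X) = ch.
Proof. by []. Qed.

(* Weaker than [/=], which would also rewrite the types of the channels. *)
Ltac eval_chan :=
  rewrite !chan_config; lazy beta iota delta [emit foldl map append pop fst snd];
  rewrite ?val_ports -/nB -/nC ?node_eqs; lazy beta iota delta [andb].

Ltac count_lia :=
  repeat match goal with
  | |- context [occ ?i ?s] => move: (occ i s) => ?
  | |- context [hits ?m ?i ?s] => move: (hits m i s) => ?
  end; lia.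

(** A send adds one unit, for a fresh id only. A reception by [m] turns a channel unit into a hit,
    and forwarding by [m'] moves a unit from the host channel of [m'] to the channel towards [m].
    Packets coming from the other middlebox are never forwarded, so no step creates a second
    unit. *)
Lemma id_run_visits ids rcv c : id_run ids rcv c -> forall i,
  visits rcv c i mB mC <= (i \in ids) /\ visits rcv c i mC mB <= (i \in ids).
Proof.
elim=> {ids rcv c} [//|ids rcv c h v p i _ IH hv _ iids|
    ids rcv c m pr i p r q o q' s _ IH mq cp dq so|
    ids rcv c m pr i p r q _ IH mq cp dq] j; move: (IH j);
  rewrite /visits -/nB -/nC => {IH} IH.
- have hh : inl h = nh by case: (nodeE (inl h)).
  have vBC : v = nB \/ v = nC.
    by case: (nodeE v) => vE; [move: hv; rewrite vE; case: h {hh} => [[]]|left|right].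
  rewrite hh in_cons; have [eqij|neij] := eqVneq j i.
    (* A fresh id had bound 0, so the unit added by this send is its only one. *)
    subst j; rewrite (negPf iids) in IH.
    by case: vBC => ->; eval_chan; rewrite !occ_rcons eqxx orTb; move: IH; count_lia.
  by case: vBC => ->; eval_chan; rewrite !occ_rcons eq_sym (negPf neij) !addn0.
- rewrite !hits_cons; case: (mboxE m) => ?; subst m.
    case: (deltaB dq so) => {so dq} [e ? ?|b e ? ?|b e ? ?|e ? ?]; subst p pr;
    move: IH; eval_chan; rewrite -/nB val_ports in cp; rewrite cp occ_cons ?occ_rcons;
    lazy beta iota delta [behead]; count_lia.
  case: (deltaC dq so) => {so dq} b eq eq' ? ?; subst p pr;
    move: IH; eval_chan; rewrite -/nC val_ports in cp; rewrite cp occ_cons ?occ_rcons;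
    lazy beta iota delta [behead]; count_lia.
- rewrite !hits_cons; case: (mboxE m) => ?; subst m;
    [case: (portBE pr)|case: (portCE pr)] => ?; subst pr;
    move: IH; eval_chan; rewrite -/nB -/nC val_ports in cp; rewrite cp occ_cons;
    lazy beta iota delta [behead]; count_lia.
Qed.

Lemma no_forwarding_loop : ~ forwarding_loop N.
Proof.
case=> ids [rcv [c [/id_run_visits vis]]]; apply/negP; rewrite negbK.
apply: count_mem_uniq => -[m i]; have [visB visC] := vis i.
have : count_mem (m, i) rcv <= 1.
  case: (mboxE m) => ->; [apply: leq_trans (leq_trans _ visB) (leq_b1 _)|
    apply: leq_trans (leq_trans _ visC) (leq_b1 _)];
    by rewrite /visits -!addnA leq_addr.
rewrite -has_pred1 has_count.
by case: (count_mem (m, i) rcv) => [|[]].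
Qed.
End QueueNetwork.

(** * Register programs *)

Inductive ract := Inc of nat | Dec of nat | Zero of nat.

Definition store := nat -> nat.

Definition upd (s : store) (r n : nat) : store :=
  fun i => if i == r then n else s i.

Definition rsem (a : ract) (s s' : store) : Prop :=
  match a with
  | Inc r => s' = upd s r (s r).+1
  | Dec r => 0 < s r /\ s' = upd s r (s r).-1
  | Zero r => s r = 0 /\ s' = s
  end.

Definition reg (a : ract) : nat := match a with Inc r | Dec r | Zero r => r end.

(** A strict upper bound on the registers mentioned, hence free to serve as an end marker. *)
Fixpoint width (p : prog ract) : nat :=
  match p with
  | Skip => 0
  | Atom a => (reg a).+1
  | Seq p q | Alt p q => maxn (width p) (width q)
  | Star p => width p
  end.

(** A prefix-free unary code. Symbol 0 is the single bit [false], so [n] loaded bits are [n] copies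
    of symbol 0, that is, the value [n] in register 0. *)
Definition enc1 (r : nat) : seq bool := rcons (nseq r true) false.

Definition enc (u : seq nat) : seq bool := flatten (map enc1 u).

Lemma enc_rcons u r : enc (rcons u r) = enc u ++ enc1 r.
Proof. by rewrite /enc map_rcons flatten_rcons. Qed.

Lemma enc1_cancel x y v v' : enc1 x ++ v = enc1 y ++ v' -> x = y /\ v = v'.
Proof.
rewrite /enc1; elim: x y => [|x IH] [|y] //=; first by case.
by case=> /IH [-> ->].
Qed.

(** Prefix-freeness: popping the bits of a symbol succeeds only if exactly this symbol is at the
    head, so pops never cut a code word in two. *)
Lemma enc_head u x v : enc u = enc1 x ++ v -> exists2 u', u = x :: u' & v = enc u'.
Proof.
case: u => [|y u] /=; first by case: x.
by case/(@enc1_cancel y x) => <- <-; exists u.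
Qed.

Definition push_sym (r : nat) : prog qact :=
  iter r (Seq (Atom (Push true))) (Atom (Push false)).

Definition pop_sym (r : nat) : prog qact :=
  iter r (Seq (Atom (Pop true))) (Atom (Pop false)).

Definition rotate (r : nat) : prog qact := pop_sym r >> push_sym r.

Definition rotate_any (s : seq nat) : prog qact :=
  Star (foldr (fun r p => Alt (rotate r) p) Skip s).

Lemma push_symP r w w' : sem qsem (push_sym r) w w' <-> w' = w ++ enc1 r.
Proof.
elim: r w w' => [|r IH] w w' /=; first by rewrite -cats1.
rewrite -/(push_sym r); split=> [[v [-> /IH ->]]|->]; first by rewrite cat_rcons.
by exists (rcons w true); split=> //; apply/IH; rewrite cat_rcons.
Qed.

Lemma pop_symP r w w' : sem qsem (pop_sym r) w w' <-> w = enc1 r ++ w'.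
Proof.
elim: r w w' => [|r IH] w w' //=; rewrite -/(pop_sym r).
split=> [[v [-> /IH ->]]//|->].
by exists (enc1 r ++ w'); split=> //; apply/IH.
Qed.

Lemma rotate_enc r u w' : sem qsem (rotate r) (enc u) w' <->
  exists2 u', u = r :: u' & w' = enc (rcons u' r).
Proof.
split=> [[v [/pop_symP /enc_head [u' -> ->] /push_symP ->]]|[u' -> ->]].
  by exists u'; rewrite ?enc_rcons.
exists (enc u'); split; first exact/pop_symP.
by apply/push_symP; rewrite enc_rcons.
Qed.

Lemma rotate_one s u w' :
  sem qsem (foldr (fun r p => Alt (rotate r) p) Skip s) (enc u) w' <->
  w' = enc u \/ exists r u', [/\ r \in s, u = r :: u' & w' = enc (rcons u' r)].
Proof.
elim: s u w' => [|r s IH] u w' /=.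
  by split=> [->|[//|[r [u' []]]//]]; left.
split.
  case=> [/rotate_enc [u' -> ->]|/IH [->|[r' [u' [rs -> ->]]]]]; last 2 first.
  - by left.
  - by right; exists r', u'; rewrite inE rs orbT.
  by right; exists r, u'; rewrite inE eqxx.
case=> [->|[r' [u' []]]]; first by right; apply/IH; left.
rewrite inE => /orP[/eqP-> -> ->|rs -> ->].
  by left; apply/rotate_enc; exists u'.
by right; apply/IH; right; exists r', u'.
Qed.

Lemma rotate_any_inv s (P : seq nat -> Prop) u w :
  (forall r u', r \in s -> P (r :: u') -> P (rcons u' r)) -> P u ->
  sem qsem (rotate_any s) (enc u) w -> exists2 u', w = enc u' & P u'.
Proof.
move=> Pstep Pu /=; move eqv: (enc u) => v sv.
elim: sv u eqv Pu => [v1 u <- Pu|v1 v2 v3 v12 _ IH u eqv Pu]; first by exists u.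
rewrite -eqv in v12; case/rotate_one: v12 => [ev|[r [u' [rs eu ev]]]].
  by apply: IH Pu.
by apply: (IH (rcons u' r)) => //; apply: Pstep; rewrite // -eu.
Qed.

Lemma rotate_any_complete s u v : {subset u <= s} ->
  sem qsem (rotate_any s) (enc (u ++ v)) (enc (v ++ u)).
Proof.
elim: u v => [|r u IH] v us; first by rewrite cats0; apply: star_refl.
apply: (@star_step _ _ _ (enc (rcons (u ++ v) r))).
  by apply/rotate_one; right; exists r, (u ++ v); rewrite us ?inE ?eqxx.
rewrite rcons_cat -cat_rcons; apply: IH => i iu.
by apply: us; rewrite inE iu orbT.
Qed.

(** * Register operations as queue programs *)

Section Translation.

Variable K : nat.

(* [K] is not a register: it marks the end of the queue. *)
Definition translate (a : ract) : prog qact :=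
  match a with
  | Inc r => push_sym r
  | Dec r => rotate_any (iota 0 K) >> pop_sym r
  | Zero r => push_sym K >> rotate_any [seq i <- iota 0 K | i != r] >> pop_sym K
  end.

Definition represents (w : seq bool) (s : store) : Prop :=
  exists u, [/\ w = enc u, all (fun r => r < K) u & forall r, s r = count_mem r u].

Lemma translate_sound a w w' s : reg a < K -> represents w s ->
  sem qsem (translate a) w w' -> exists2 s', rsem a s s' & represents w' s'.
Proof.
move=> aK [u [-> uK su]].
case: a aK => r /= rK.
- move=> /push_symP ->; exists (upd s r (s r).+1) => //.
  exists (rcons u r); rewrite enc_rcons all_rcons rK; split=> // i.
  rewrite /upd -cats1 count_cat /= -!su addn0 eq_sym.
  by case: eqVneq => [->|]; rewrite ?addn1 ?addn0.
- case=> v [rot].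
  (* Rotations only permute the symbols, so every count is preserved until one [r] is popped. *)
  have [|u' -> pu] := rotate_any_inv (P := perm_eq u) _ (perm_refl u) rot.
    by move=> i u' _ /perm_trans -> //; rewrite perm_sym perm_rcons.
  move=> /pop_symP /enc_head [u'' eu ->]; rewrite eu in pu => {eu u'}.
  have sr : s r = (count_mem r u'').+1.
    by rewrite su (permP pu) /= eqxx.
  exists (upd s r (s r).-1); first by rewrite sr.
  exists u''; split=> // [|i].
    by move: uK; rewrite (perm_all _ pu) /= => /andP[].
  rewrite /upd sr /= su (permP pu) /= eq_sym; by case: eqVneq => [->|].
- case=> v [/push_symP ->] [v' []]; rewrite -enc_rcons => rot.
  (* The marker separates the symbols [u2] still to be inspected from those, [u1], already rotated
     behind it; the latter avoid [r]. *)
  pose P v := exists u1 u2, [/\ u = u1 ++ u2, v = u2 ++ K :: u1 & r \notin u1].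
  have [||v'' -> [u1 [u2 [eu -> rn]]]] := rotate_any_inv (P := P) _ _ rot.
  + move=> i u' + [u1 [u2 [e1 + rn]]].
    rewrite mem_filter mem_iota => /and3P[ir _ iK].
    case: u2 e1 => [|j u2] e1 [] eij ->; first by rewrite eij ltnn in iK.
    subst j; exists (rcons u1 i), u2.
    by rewrite mem_rcons inE negb_or eq_sym ir e1 cat_rcons rcons_cat.
  + by exists [::], u; rewrite cats1.
  move=> /pop_symP; case/enc_head => u'.
  (* The marker can be popped only when it is at the head, that is, when all of [u] has been
     inspected. *)
  case: u2 eu => [|j u2] eu []; last first.
    by move=> eK; move: uK; rewrite eu all_cat /= eK ltnn andbF.
  move=> <- ->; rewrite cats0 in eu; subst u1.
  exists s; first by rewrite su; split=> //; apply/count_memPn.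
  by exists u.
Qed.

Lemma translate_complete a w s s' : reg a < K -> represents w s ->
  rsem a s s' -> exists2 w', sem qsem (translate a) w w' & represents w' s'.
Proof.
move=> aK [u [-> uK su]].
case: a aK => r /= rK.
- move=> ->; exists (enc (rcons u r)); first by apply/push_symP; rewrite enc_rcons.
  exists (rcons u r); rewrite all_rcons rK; split=> // i.
  rewrite /upd -cats1 count_cat /= -!su addn0 eq_sym.
  by case: eqVneq => [->|]; rewrite ?addn1 ?addn0.
- case=> sr ->.
  have ru : r \in u by rewrite -has_pred1 has_count -su.
  (* Rotating the symbols before one occurrence of [r] brings it to the head. *)
  case/splitPr: ru su uK => u1 u2 su; rewrite all_cat /= => /and3P[u1K _ u2K].
  exists (enc (u2 ++ u1)).
    exists (enc ((r :: u2) ++ u1)); split; last exact/pop_symP.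
    by apply: rotate_any_complete => i iu; rewrite mem_iota /= (allP u1K).
  exists (u2 ++ u1); rewrite all_cat u1K u2K; split=> // i.
  rewrite /upd !su !count_cat /= eqxx; case: eqVneq => [->|_]; lia.
- case=> sr ->; exists (enc u); last by exists u.
  exists (enc (u ++ [:: K])); split; first by apply/push_symP; rewrite cats1 enc_rcons.
  exists (enc ([:: K] ++ u)); split; last exact/pop_symP.
  apply: rotate_any_complete => i iu; rewrite mem_filter mem_iota /= (allP uK) // andbT.
  by apply: contraPneq iu => ->; apply/negP/count_memPn; rewrite -su.
Qed.

Fixpoint compile (p : prog ract) : prog qact :=
  match p with
  | Skip => Skip
  | Atom a => translate a
  | Seq p q => Seq (compile p) (compile q)
  | Alt p q => Alt (compile p) (compile q)
  | Star p => Star (compile p)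
  end.

Lemma compile_sound p w w' s : width p <= K -> represents w s ->
  sem qsem (compile p) w w' -> exists2 s', sem rsem p s s' & represents w' s'.
Proof.
elim: p w w' s => [|a|p IHp q IHq|p IHp q IHq|p IHp] w w' s /=.
- by move=> _ ws ->; exists s.
- exact: translate_sound.
- rewrite geq_max => /andP[pK qK] ws [v [pv qv]].
  have [t st vt] := IHp _ _ _ pK ws pv; have [s' ts' ws'] := IHq _ _ _ qK vt qv.
  by exists s' => //; exists t.
- rewrite geq_max => /andP[pK qK] ws [pv|qv].
    by have [s' ts' ws'] := IHp _ _ _ pK ws pv; exists s' => //; left.
  by have [s' ts' ws'] := IHq _ _ _ qK ws qv; exists s' => //; right.
- move=> pK ws pw; elim: pw s ws => [v|v1 v2 v3 v12 _ IH] s ws.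
    by exists s => //; apply: star_refl.
  have [t st vt] := IHp _ _ _ pK ws v12; have [s' ts' ws'] := IH _ vt.
  by exists s' => //; apply: star_step st ts'.
Qed.

Lemma compile_complete p w s s' : width p <= K -> represents w s ->
  sem rsem p s s' -> exists2 w', sem qsem (compile p) w w' & represents w' s'.
Proof.
elim: p w s s' => [|a|p IHp q IHq|p IHp q IHq|p IHp] w s s' /=.
- by move=> _ ws ->; exists w.
- exact: translate_complete.
- rewrite geq_max => /andP[pK qK] ws [v [pv qv]].
  have [t st vt] := IHp _ _ _ pK ws pv; have [w' ts' ws'] := IHq _ _ _ qK vt qv.
  by exists w' => //; exists t.
- rewrite geq_max => /andP[pK qK] ws [pv|qv].
    by have [w' ts' ws'] := IHp _ _ _ pK ws pv; exists w' => //; left.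
  by have [w' ts' ws'] := IHq _ _ _ qK ws qv; exists w' => //; right.
- move=> pK ws pw; elim: pw w ws => [v|v1 v2 v3 v12 _ IH] w ws.
    by exists w => //; apply: star_refl.
  have [t st vt] := IHp _ _ _ pK ws v12; have [w' ts' ws'] := IH _ vt.
  by exists w' => //; apply: star_step st ts'.
Qed.

End Translation.

(** * Register programs checking partial recursive functions *)

Local Notation rs := (sem rsem).

Ltac store_eq :=
  apply: functional_extensionality => ?; rewrite /upd;
  repeat case: eqP => ?; first [lia | congruence | subst; lia].

Definition guess (r : nat) : prog ract := Star (Atom (Inc r)).

Definition clear (r : nat) : prog ract := Star (Atom (Dec r)) >> Atom (Zero r).

Lemma upd_same s r n : upd s r n r = n.
Proof. by rewrite /upd eqxx. Qed.

Lemma upd_other s r n i : i != r -> upd s r n i = s i.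
Proof. by rewrite /upd => /negPf ->. Qed.

Lemma upd_id s r : upd s r (s r) = s.
Proof. by store_eq. Qed.

Lemma upd_upd s r m n : upd (upd s r m) r n = upd s r n.
Proof. by store_eq. Qed.

Lemma guessP r s s' : rs (guess r) s s' <-> exists n, s' = upd s r (s r + n).
Proof.
split.
  elim=> [t|t u v -> _ [n ->]]; first by exists 0; rewrite addn0 upd_id.
  by exists n.+1; store_eq.
case=> n ->; elim: n s => [|n IH] s; first by rewrite addn0 upd_id; constructor.
apply: (@star_step _ _ _ (upd s r (s r).+1)) => //.
suff -> : upd s r (s r + n.+1) =
  upd (upd s r (s r).+1) r (upd s r (s r).+1 r + n) by exact: IH.
by store_eq.
Qed.

Lemma clearP r s s' : rs (clear r) s s' <-> s' = upd s r 0.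
Proof.
split.
  case=> t [st [tr ->]]; elim: st tr => [u <-|u v w [u0 ->] _ IH /IH ->].
    by rewrite upd_id.
  by rewrite upd_upd.
move=> ->; exists (upd s r 0); split; last by rewrite /= upd_same.
move: {2}(s r) (erefl (s r)) => n; elim: n s => [|n IH] s sr.
  by rewrite -sr upd_id; constructor.
apply: (@star_step _ _ _ (upd s r n)); first by rewrite /= sr.
by rewrite -(upd_upd s r n 0); apply: IH; rewrite upd_same.
Qed.

Definition eqtest (x y t : nat) : prog ract :=
  Star (Atom (Dec x) >> Atom (Dec y) >> Atom (Inc t)) >>
  Atom (Zero x) >> Atom (Zero y) >>
  Star (Atom (Dec t) >> Atom (Inc x) >> Atom (Inc y)) >> Atom (Zero t).

(** Both registers are emptied in step while [t] counts the rounds, then refilled from [t]. The zero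
    tests force the first loop to exhaust both registers and the second to undo it completely. *)
Lemma eqtestP x y t s s' : x != y -> t != x -> t != y -> s t = 0 ->
  rs (eqtest x y t) s s' <-> s' = s /\ s x = s y.
Proof.
move=> xy tx ty st0.
(* [F] and [G] are the effects of [k] rounds of the emptying and of the refilling loop. *)
pose F s k := upd (upd (upd s x (s x - k)) y (s y - k)) t (s t + k).
pose G s k := upd (upd (upd s t (s t - k)) x (s x + k)) y (s y + k).
have yx : y != x by rewrite eq_sym.
have xt : x != t by rewrite eq_sym.
have yt : y != t by rewrite eq_sym.
have F0 u : F u 0 = u by rewrite /F; store_eq.
have G0 u : G u 0 = u by rewrite /G; store_eq.
have FS u k : F (F u 1) k = F u k.+1.
  by rewrite /F; apply: functional_extensionality => i; rewrite /upd;
    do ?[case: (eqVneq i _) => ?; subst]; rewrite ?eqxx ?(negPf xy) ?(negPf tx)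
      ?(negPf ty) ?(negPf yx) ?(negPf xt) ?(negPf yt); lia.
have GS u k : G (G u 1) k = G u k.+1.
  by rewrite /G; apply: functional_extensionality => i; rewrite /upd;
    do ?[case: (eqVneq i _) => ?; subst]; rewrite ?eqxx ?(negPf xy) ?(negPf tx)
      ?(negPf ty) ?(negPf yx) ?(negPf xt) ?(negPf yt); lia.
have F1 u v : rs (Atom (Dec x) >> Atom (Dec y) >> Atom (Inc t)) u v <->
    [/\ 0 < u x, 0 < u y & v = F u 1].
  have eF : F u 1 = upd (upd (upd u x (u x).-1) y (u y).-1) t (u t).+1.
    by rewrite /F !subn1 addn1.
  rewrite eF; split.
    case=> u1 [[ux ->] [u2 [[uy ->] /= ->]]]; move: uy.
    by rewrite !upd_other.
  case=> ux uy ->; exists (upd u x (u x).-1); split=> //.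
  exists (upd (upd u x (u x).-1) y (u y).-1); split=> /=; rewrite !upd_other //.
have G1 u v : rs (Atom (Dec t) >> Atom (Inc x) >> Atom (Inc y)) u v <->
    0 < u t /\ v = G u 1.
  have eG : G u 1 = upd (upd (upd u t (u t).-1) x (u x).+1) y (u y).+1.
    by rewrite /G !subn1 !addn1.
  rewrite eG; split.
    by case=> u1 [[ux ->] [u2 [-> /= ->]]]; rewrite !upd_other.
  case=> ut ->; exists (upd u t (u t).-1); split=> //.
  exists (upd (upd u t (u t).-1) x (u x).+1); split=> /=; rewrite !upd_other //.
have Fx u k : F u k x = u x - k by rewrite /F upd_other // upd_other // upd_same.
have Fy u k : F u k y = u y - k by rewrite /F upd_other // upd_same.
have Ft u k : F u k t = u t + k by rewrite /F upd_same.
have Gt u k : G u k t = u t - k by rewrite /G upd_other // upd_other // upd_same.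
have GF u k : u t = 0 -> k <= u x -> k <= u y -> G (F u k) k = u.
  by move=> u0 kx ky; rewrite /G /F; apply: functional_extensionality => i; rewrite /upd;
    do ?[case: (eqVneq i _) => ?; subst]; rewrite ?eqxx ?(negPf xy) ?(negPf tx)
      ?(negPf ty) ?(negPf yx) ?(negPf xt) ?(negPf yt); lia.
split.
  case=> u1 [su [u2 [[u1x ->] [u3 [[u1y ->] [u4 [su4 [u4t ->]]]]]]]].
  have [k [kx ky eu1]] : exists k, [/\ k <= s x, k <= s y & u1 = F s k].
    elim: su {u1x u1y su4 st0} => [u|u v w /F1 [ux uy ->] _ [k []]].
      by exists 0; rewrite F0.
    rewrite Fx Fy => kx ky ->; exists k.+1; rewrite FS; split=> //; lia.
  have [l lt eu4] : exists2 l, l <= u1 t & u4 = G u1 l.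
    elim: su4 {u1x u1y su u4t eu1} => [u|u v w /G1 [ut ->] _ [l]].
      by exists 0; rewrite ?G0.
    by rewrite Gt => lt ->; exists l.+1; rewrite ?GS //; lia.
  rewrite eu1 Ft st0 in lt; rewrite eu4 Gt eu1 Ft st0 in u4t.
  (* As [t] was 0 at first and is 0 at the end, both loops ran equally often. *)
  have lk : l = k by lia.
  by rewrite eu4 lk eu1 GF //; move: u1x u1y; rewrite eu1 Fx Fy; split=> //; lia.
case=> -> sxy; exists (F s (s x)); split.
  suff st k : k <= s x -> k <= s y -> rs (Star
    (Atom (Dec x) >> Atom (Dec y) >> Atom (Inc t))) s (F s k) by apply: st; lia.
  elim: k s {sxy st0} => [|k IH] s kx ky; first by rewrite F0; constructor.
  apply: (@star_step _ _ _ (F s 1)); first by apply/F1; split=> //; lia.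
  by rewrite -(FS s k); apply: IH; rewrite ?Fx ?Fy; lia.
exists (F s (s x)); split; first by rewrite /= Fx subnn.
exists (F s (s x)); split; first by rewrite /= Fy sxy subnn.
exists s; split=> //.
suff st u k : k <= u t -> rs (Star
    (Atom (Dec t) >> Atom (Inc x) >> Atom (Inc y))) u (G u k).
  rewrite -[X in rs _ _ X](@GF s (s x)) -?sxy //.
  by apply: st; rewrite Ft; lia.
elim: k u => [|k IH] u kt; first by rewrite G0; constructor.
apply: (@star_step _ _ _ (G u 1)); first by apply/G1; split=> //; lia.
by rewrite -(GS u k); apply: IH; rewrite Gt; lia.
Qed.

(** * Blocks of consecutive registers *)

Fixpoint fill (s : store) (b : nat) (w : seq nat) : store :=
  if w is x :: w then fill (upd s b x) b.+1 w else s.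

Lemma fillE s b w r :
  fill s b w r = if b <= r < b + size w then nth 0 w (r - b) else s r.
Proof.
elim: w s b => [|x w IH] s b /=; first by rewrite addn0; case: ifP => //; lia.
rewrite IH; case: (ltngtP b r) => [br|br|<-].
- rewrite addSnnS; case: ifP => // _; first by rewrite -(subnSK br).
  by rewrite upd_other //; lia.
- by rewrite upd_other //; lia.
- by rewrite subnn /= upd_same ifT //; lia.
Qed.

Lemma fill_id s b w : (forall i, i < size w -> nth 0 w i = s (b + i)) ->
  fill s b w = s.
Proof.
move=> ws; apply: functional_extensionality => r; rewrite fillE.
by case: ifP => // br; rewrite ws ?subnKC //; lia.
Qed.

Lemma fill_fill s b w w' : size w = size w' -> fill (fill s b w) b w' = fill s b w'.
Proof.
move=> ww'; apply: functional_extensionality => r; rewrite !fillE ww'.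
by case: ifP => // ->.
Qed.

Fixpoint guesses (b k : nat) : prog ract :=
  if k is k'.+1 then guess b >> guesses b.+1 k' else Skip.

Fixpoint clears (b k : nat) : prog ract :=
  if k is k'.+1 then clear b >> clears b.+1 k' else Skip.

Lemma guessesP b k s s' : (forall r, b <= r -> s r = 0) ->
  rs (guesses b k) s s' <-> exists2 w, size w = k & s' = fill s b w.
Proof.
elim: k b s s' => [|k IH] b s s' s0 /=.
  by split=> [->|[[] // _ ->]]; first exists [::].
split.
  case=> t [/guessP [x ->]]; rewrite s0 // add0n => /IH [r br|w sw ->].
    by rewrite upd_other ?s0; lia.
  by exists (x :: w); rewrite //= sw.
case=> -[//|x w] [sw] ->; exists (upd s b x); split.
  by apply/guessP; exists x; rewrite s0.
by apply/IH; [move=> r br; rewrite upd_other ?s0; lia|exists w].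
Qed.

Lemma clearsP b k s s' : rs (clears b k) s s' <-> s' = fill s b (nseq k 0).
Proof.
elim: k b s s' => [|k IH] b s s' //=.
by split=> [[t [/clearP -> /IH]]|->] //; exists (upd s b 0); split; [apply/clearP|apply/IH].
Qed.

Definition seqs (ps : seq (prog ract)) : prog ract := foldr (@Seq ract) Skip ps.

(** Tests leave the store unchanged, so their sequence is a conjunction. *)
Lemma seqs_tests (T : eqType) (l : seq T) (P : T -> prog ract) (C : T -> Prop) s s' :
  (forall i t, rs (P i) s t <-> t = s /\ C i) ->
  rs (seqs (map P l)) s s' <-> s' = s /\ forall i, i \in l -> C i.
Proof.
move=> PC; elim: l s' => [|i l IH] s' /=; first by split=> [->|[]].
split=> [[t [/PC [-> Ci] /IH [-> Cl]]]|[-> Cl]].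
  by split=> // j; rewrite inE => /orP[/eqP->|/Cl].
exists s; split; first by apply/PC; split=> //; apply: Cl; rewrite inE eqxx.
by apply/IH; split=> // j jl; apply: Cl; rewrite inE jl orbT.
Qed.

Arguments sem : simpl never.

(* [check f a o b] tests whether [f] maps the contents of the registers [a] to
   that of the register [o]; the registers from [b] on are free.  Intermediate
   results are guessed and erased again, so that a successful test leaves the
   store unchanged. *)
Fixpoint check n (f : recf n) : n.-tuple nat -> nat -> nat -> prog ract :=
  match f in recf n return n.-tuple nat -> nat -> nat -> prog ract with
  | rzero _ => fun _ o _ => Atom (Zero o)
  | rsucc => fun a o b => Atom (Dec o) >> eqtest (thead a) o b >> Atom (Inc o)
  | rproj _ i => fun a o b => eqtest (tnth a i) o b
  | rcomp n k f g => fun a o b =>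
      guesses b k >>
      seqs [seq check (g i) a (b + i) (b + k) | i <- enum 'I_k] >>
      check f [tuple b + i | i < k] o (b + k) >>
      clears b k
  | rprec n f g => fun a o b =>
      let params : n.-tuple nat := [tuple of behead a] in
      guess b.+1 >> check f params b.+1 b.+3 >>
      Star (guess b.+2 >>
            check g [tuple of b :: b.+1 :: params] b.+2 b.+3 >>
            clear b.+1 >> guess b.+1 >> eqtest b.+1 b.+2 b.+3 >> clear b.+2 >>
            Atom (Inc b)) >>
      eqtest b (thead a) b.+3 >> eqtest b.+1 o b.+3 >> clear b >> clear b.+1
  | rmu n f => fun a o b =>
      Star (guess b.+1 >> Atom (Inc b.+1) >>
            check f [tuple of b :: a] b.+1 b.+2 >> clear b.+1 >> Atom (Inc b)) >>
      eqtest b o b.+2 >> check f [tuple of b :: a] b.+1 b.+2 >> clear b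
  end.

Definition scratch (s : store) (b : nat) : Prop := forall r, b <= r -> s r = 0.

(** The output register lies outside the arguments because [eqtest] compares distinct registers. *)
Definition fits n (a : n.-tuple nat) (o b : nat) : Prop :=
  [/\ all (fun r => r < b) a, o < b & o \notin a].

Definition vals n (s : store) (a : n.-tuple nat) : n.-tuple nat :=
  [tuple of map s a].

Definition checks n (f : recf n) : Prop := forall a o b s s',
  fits a o b -> scratch s b ->
  rs (check f a o b) s s' <-> s' = s /\ reval f (vals s a) (s o).

Lemma checks_rzero n : checks (rzero n).
Proof. by move=> a o b s s' _ _ /=; split=> -[]. Qed.

Lemma checks_rproj n (i : 'I_n) : checks (rproj i).
Proof.
move=> a o b s s' [/allP ab ob oa] sb /=; rewrite tnth_map.
have ia := mem_tnth i a.
have ao : tnth a i != o by apply: contraNneq oa => <-.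
have ba : b != tnth a i by rewrite gtn_eqF //; apply: ab.
have bo : b != o by rewrite gtn_eqF.
have eP := eqtestP s' ao ba bo (sb _ (leqnn b)).
by split=> [/eP [-> ->] //|[es eo]]; apply/eP.
Qed.

(** The output is decremented, compared with the argument and restored; the decrement also rejects
    an output of 0. *)
Lemma checks_rsucc : checks rsucc.
Proof.
move=> a o b s s' [/allP ab ob oa] sb /=.
have ia : thead a \in tval a by apply: mem_tnth.
have ao : thead a != o by apply: contraNneq oa => <-.
have ba : b != thead a by rewrite gtn_eqF //; apply: ab.
have bo : b != o by rewrite gtn_eqF.
have -> : thead (vals s a) = s (thead a) by rewrite /thead tnth_map.
have eqP1 t : rs (eqtest (thead a) o b) (upd s o (s o).-1) t <->
    t = upd s o (s o).-1 /\ s (thead a) = (s o).-1.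
  move: (@eqtestP _ _ _ (upd s o (s o).-1) t ao ba bo).
  by rewrite upd_same [upd _ _ _ b]upd_other // upd_other // sb //; apply.
split.
  case=> t [[so ->] [u [/eqP1 [-> sa] ->]]].
  rewrite upd_same upd_upd prednK // upd_id; split=> //; lia.
case=> -> sa; exists (upd s o (s o).-1); split; first by split=> //; lia.
exists (upd s o (s o).-1); split; first by apply/eqP1; split=> //; lia.
by rewrite /sem /= upd_same upd_upd prednK ?upd_id //; lia.
Qed.

Lemma vals_eq n (a : n.-tuple nat) s s' :
  {in a, s =1 s'} -> vals s a = vals s' a.
Proof. by move=> ss'; apply: val_inj; apply/eq_in_map. Qed.


(** The registers [b], ..., [b + k - 1] hold the guessed values of the inner functions, and all
    nested checks use scratch space from [b + k] on. *)
Lemma checks_rcomp n k (f : recf k) (g : 'I_k -> recf n) :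
  checks f -> (forall i, checks (g i)) -> checks (rcomp f g).
Proof.
move=> IHf IHg a o b s s' [/allP ab ob oa] sb.
pose S (w : k.-tuple nat) := fill s b w.
have Sa w : {in a, S w =1 s}.
  by move=> r ra; rewrite /S fillE ifF //; have := ab r ra; lia.
have So w : S w o = s o by rewrite /S fillE ifF //; lia.
have Sscr w : scratch (S w) (b + k).
  by move=> r br; rewrite /S fillE size_tuple ifF ?sb //; lia.
have Si w (i : 'I_k) : S w (b + i) = tnth w i.
  rewrite /S fillE size_tuple ifT; first by rewrite addKn (tnth_nth 0).
  by have := ltn_ord i; lia.
have gP w t : rs (seqs [seq check (g i) a (b + i) (b + k) | i <- enum 'I_k]) (S w) t
    <-> t = S w /\ forall i, i \in enum 'I_k -> reval (g i) (vals s a) (tnth w i).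
  apply: seqs_tests => i u; rewrite -Si -(vals_eq (Sa w)); apply: IHg => //; split.
  - by apply/allP => r /ab; lia.
  - by have := ltn_ord i; lia.
  - by apply/negP => /ab; lia.
have fP w t : rs (check f [tuple b + i | i < k] o (b + k)) (S w) t <->
    t = S w /\ reval f w (s o).
  have vw : vals (S w) [tuple b + i | i < k] = w.
    by apply: eq_from_tnth => i; rewrite tnth_map tnth_mktuple Si.
  have := IHf [tuple b + i | i < k] o (b + k) (S w) t; rewrite vw So; apply=> //.
  split.
  - by apply/allP => r /mapP [i _ ->]; have := ltn_ord i; lia.
  - by lia.
  - by apply/negP => /mapP [i _ oi]; lia.
have cP w : fill (S w) b (nseq k 0) = s.
  rewrite fill_fill ?size_tuple ?size_nseq // fill_id // => i.
  by rewrite size_nseq => ik; rewrite nth_nseq ik sb // leq_addr.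
split.
  case=> t [/(guessesP _ _ sb) [w0 sw ->]].
  pose w := tcast sw (in_tuple w0).
  have -> : fill s b w0 = S w by rewrite /S val_tcast.
  case=> t1 [/gP [-> gw]] [t2 [/fP [-> fw]]] /clearsP ->; rewrite cP; split=> //.
  by exists w; split=> // i; apply: gw; rewrite mem_enum.
case=> -> /= [w [gw fw]]; exists (S w); split.
  by apply/(guessesP _ _ sb); exists w; rewrite ?size_tuple.
exists (S w); split; first by apply/gP; split=> // i _.
by exists (S w); split; [apply/fP|apply/clearsP; rewrite cP].
Qed.

(** Names the anonymous recursion inside [reval], so that inductions on it can be stated. *)
Fixpoint prec_loop n (f : recf n) (g : recf n.+2) (v : n.-tuple nat) k : nat -> Prop :=
  if k is k'.+1 then fun y =>
    exists z, prec_loop f g v k' z /\ reval g [tuple of k' :: z :: v] y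
  else reval f v.

Lemma prec_loopS n (f : recf n) (g : recf n.+2) v k z y :
  prec_loop f g v k z -> reval g [tuple of k :: z :: v] y ->
  prec_loop f g v k.+1 y.
Proof. by move=> lz gy; exists z. Qed.

Lemma reval_rprec n (f : recf n) (g : recf n.+2) v y :
  reval (rprec f g) v y <-> prec_loop f g [tuple of behead v] (thead v) y.
Proof.
rewrite /=; elim: (thead v) y => [|k IH] y //=.
by split=> -[z [/IH lz gz]]; exists z.
Qed.

(** Register [b] holds the recursion index, [b.+1] the value reached there and [b.+2] a guess of the
    next value. [S] and [T] describe the store without and with that guess. *)
Lemma checks_rprec n (f : recf n) (g : recf n.+2) :
  checks f -> checks g -> checks (rprec f g).
Proof.
move=> IHf IHg a o b s s' [/allP ab ob oa] sb.
pose ps : n.-tuple nat := [tuple of behead a].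
have psa r : r \in ps -> r < b by move=> /mem_behead /ab.
have a0b : thead a < b by apply: ab; apply: mem_tnth.
have a0o : thead a != o by apply: contraNneq oa => <-; apply: mem_tnth.
pose S i z := upd (upd s b i) b.+1 z.
pose T i z y := upd (S i z) b.+2 y.
have Slt i z r : r < b -> S i z r = s r by move=> rb; rewrite /S !upd_other //; lia.
have Tlt i z y r : r < b -> T i z y r = s r.
  by move=> rb; rewrite /T upd_other ?Slt //; lia.
have Sscr i z : scratch (S i z) b.+2.
  by move=> r rb; rewrite /S !upd_other ?sb //; lia.
have Tscr i z y : scratch (T i z y) b.+3.
  by move=> r rb; rewrite /T upd_other ?Sscr //; lia.
have Sb i z : S i z b = i by rewrite /S upd_other ?upd_same //; lia.
have Sb1 i z : S i z b.+1 = z by rewrite /S upd_same.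
have Tb i z y : T i z y b = i by rewrite /T upd_other ?Sb //; lia.
have Tb1 i z y : T i z y b.+1 = z by rewrite /T upd_other ?Sb1 //; lia.
have Tb2 i z y : T i z y b.+2 = y by rewrite /T upd_same.
have T0 i z : T i z 0 = S i z.
  by rewrite /T -[RHS](upd_id _ b.+2) Sscr.
have S00 : S 0 0 = s by rewrite /S -{1}(sb b) // upd_id -(sb b.+1) // upd_id.
have valS i z : vals (S i z) ps = [tuple of behead (vals s a)].
  apply: val_inj => /=; rewrite behead_map; apply/eq_in_map => r /psa; exact: Slt.
have valT i z y : vals (T i z y) [tuple of b :: b.+1 :: ps] =
    [tuple of i :: z :: [tuple of behead (vals s a)]].
  apply: val_inj => /=; rewrite Tb Tb1 behead_map; congr (_ :: _ :: _).
  by apply/eq_in_map => r /psa; apply: Tlt.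
have th : thead (vals s a) = s (thead a) by rewrite /thead tnth_map.
have fP z t : rs (check f ps b.+1 b.+3) (S 0 z) t <->
    t = S 0 z /\ reval f [tuple of behead (vals s a)] z.
  have := IHf ps b.+1 b.+3 (S 0 z) t; rewrite valS Sb1; apply.
    by split; [apply/allP => r /psa; lia|lia|apply/negP => /psa; lia].
  by move=> r rb; apply: Sscr; lia.
have gP i z y t : rs (check g [tuple of b :: b.+1 :: ps] b.+2 b.+3) (T i z y) t <->
    t = T i z y /\ reval g [tuple of i :: z :: [tuple of behead (vals s a)]] y.
  have := IHg [tuple of b :: b.+1 :: ps] b.+2 b.+3 (T i z y) t.
  rewrite valT Tb2; apply=> //; split.
  - by rewrite /=; apply/and3P; split; try lia; apply/allP => r /psa; lia.
  - by lia.
  - by rewrite !inE !negb_or; apply/and3P; split; try lia; apply/negP => /psa; lia.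
pose body := guess b.+2 >> check g [tuple of b :: b.+1 :: ps] b.+2 b.+3 >>
   clear b.+1 >> guess b.+1 >> eqtest b.+1 b.+2 b.+3 >> clear b.+2 >> Atom (Inc b).
have eP1 i z y t : rs (eqtest b.+1 b.+2 b.+3) (T i z y) t <->
    t = T i z y /\ z = y.
  have := @eqtestP b.+1 b.+2 b.+3 (T i z y) t.
  by rewrite Tb1 Tb2 Tscr //; apply; lia.
have T1 i z y z' : upd (T i z y) b.+1 z' = T i z' y by rewrite /T /S; store_eq.
have T2 i z y y' : upd (T i z y) b.+2 y' = T i z y' by rewrite /T upd_upd.
have S0 i z i' : upd (S i z) b i' = S i' z by rewrite /S; store_eq.
have S1 i z z' : upd (S i z) b.+1 z' = S i z' by rewrite /S upd_upd.
(* The verified guess [y] is copied into [b.+1] by clearing this register, guessing again and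
   testing for equality. *)
have bodyP i z t : rs body (S i z) t <-> exists2 y,
    reval g [tuple of i :: z :: [tuple of behead (vals s a)]] y & t = S i.+1 y.
  split.
    case=> t1 [/guessP [y ->]]; rewrite Sscr // add0n -/(T i z y).
    case=> t2 [/gP [-> gy]] [t3 [/clearP ->]] [t4 [/guessP [z' ->]]].
    rewrite upd_same upd_upd add0n T1.
    case=> t5 [/eP1 [-> zy]] [t6 [/clearP ->]]; rewrite T2 T0 => ->.
    by exists y; rewrite // Sb S0 zy.
  case=> y gy ->; exists (T i z y); split.
    by apply/guessP; exists y; rewrite Sscr.
  exists (T i z y); split; first exact/gP.
  exists (T i 0 y); split; first by apply/clearP; rewrite T1.
  exists (T i y y); split; first by apply/guessP; exists y; rewrite Tb1 T1.
  exists (T i y y); split; first exact/eP1.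
  exists (S i y); split; first by apply/clearP; rewrite T2 T0.
  by rewrite /sem /= Sb S0.
have loopP z t : reval f [tuple of behead (vals s a)] z ->
    rs (Star body) (S 0 z) t -> exists i y,
      prec_loop f g [tuple of behead (vals s a)] i y /\ t = S i y.
  move=> fz st; have: exists i y,
      prec_loop f g [tuple of behead (vals s a)] i y /\ S 0 z = S i y.
    by exists 0, z.
  elim: st => // t1 t2 t3 + _ IH [i [y [ly et]]]; rewrite {}et => /bodyP [y' gy et].
  by apply: IH; exists i.+1, y'; split=> //; exists y.
have starP i y : prec_loop f g [tuple of behead (vals s a)] i y -> exists2 z,
    reval f [tuple of behead (vals s a)] z & rs (Star body) (S 0 z) (S i y).
  elim: i y => [|i IH] y; first by exists y => //; constructor.
  case=> y' [/IH [z fz sz] gy]; exists z => //; apply: star_trans sz _.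
  by apply: star_one; apply/bodyP; exists y.
have eP2 i y t : rs (eqtest b (thead a) b.+3) (S i y) t <->
    t = S i y /\ i = s (thead a).
  have := @eqtestP b (thead a) b.+3 (S i y) t.
  by rewrite Sb (Slt _ _ (thead a)) // Sscr //; apply; lia.
have eP3 i y t : rs (eqtest b.+1 o b.+3) (S i y) t <-> t = S i y /\ y = s o.
  have := @eqtestP b.+1 o b.+3 (S i y) t.
  by rewrite Sb1 (Slt _ _ o) // Sscr //; apply; lia.
rewrite reval_rprec th; split.
  case=> t1 [/guessP [z]]; rewrite sb // add0n => ->.
  have -> : upd s b.+1 z = S 0 z by rewrite -{1}S00 S1.
  case=> t2 [/fP [-> fz]] [t3 [/(loopP _ _ fz) [i [y [ly ->]]]]].
  case=> t4 [/eP2 [-> ei]] [t5 [/eP3 [-> ey]]] [t6 [/clearP ->]] /clearP ->.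
  by rewrite S0 S1 S00 -ei -ey.
case=> -> /starP [z fz sz]; exists (S 0 z); split.
  by apply/guessP; exists z; rewrite sb // -{1}S00 S1.
exists (S 0 z); split; first exact/fP.
exists (S (s (thead a)) (s o)); split=> //.
exists (S (s (thead a)) (s o)); split; first exact/eP2.
exists (S (s (thead a)) (s o)); split; first exact/eP3.
exists (S 0 (s o)); split; first by apply/clearP; rewrite S0.
by apply/clearP; rewrite S1 S00.
Qed.

(** Register [b] runs through the candidates; each round certifies a positive value of [f], since
    the guess in [b.+1] is incremented before it is checked. The last check requires the value 0. *)
Lemma checks_rmu n (f : recf n.+1) : checks f -> checks (rmu f).
Proof.
move=> IHf a o b s s' [/allP ab ob oa] sb.
pose S i := upd s b i.
pose T i y := upd (S i) b.+1 y.
have Slt i r : r < b -> S i r = s r by move=> rb; rewrite /S !upd_other //; lia.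
have Tlt i y r : r < b -> T i y r = s r.
  by move=> rb; rewrite /T upd_other ?Slt //; lia.
have Sscr i : scratch (S i) b.+1.
  by move=> r rb; rewrite /S !upd_other ?sb //; lia.
have Tscr i y : scratch (T i y) b.+2.
  by move=> r rb; rewrite /T upd_other ?Sscr //; lia.
have Sb i : S i b = i by rewrite /S upd_same.
have Tb i y : T i y b = i by rewrite /T upd_other ?Sb //; lia.
have Tb1 i y : T i y b.+1 = y by rewrite /T upd_same.
have T0 i : T i 0 = S i by rewrite /T -[RHS](upd_id _ b.+1) Sscr.
have S00 : S 0 = s by rewrite /S -{1}(sb b) // upd_id.
have T1 i y y' : upd (T i y) b.+1 y' = T i y' by rewrite /T upd_upd.
have S0 i i' : upd (S i) b i' = S i' by rewrite /S upd_upd.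
have valT i y : vals (T i y) [tuple of b :: a] = [tuple of i :: vals s a].
  apply: val_inj => /=; rewrite Tb; congr (_ :: _).
  by apply/eq_in_map => r /ab; apply: Tlt.
have fP i y t : rs (check f [tuple of b :: a] b.+1 b.+2) (T i y) t <->
    t = T i y /\ reval f [tuple of i :: vals s a] y.
  have := IHf [tuple of b :: a] b.+1 b.+2 (T i y) t.
  rewrite valT Tb1; apply=> //; split.
  - by rewrite /= ltnW //=; apply/allP => r /ab; lia.
  - by lia.
  - by rewrite inE negb_or; apply/andP; split; [lia|apply/negP => /ab; lia].
pose body := guess b.+1 >> Atom (Inc b.+1) >>
  check f [tuple of b :: a] b.+1 b.+2 >> clear b.+1 >> Atom (Inc b).
have bodyP i t : rs body (S i) t <->
    (exists y, reval f [tuple of i :: vals s a] y.+1) /\ t = S i.+1.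
  split.
    case=> t1 [/guessP [y ->]]; rewrite Sscr // add0n -/(T i y).
    case=> t2 [-> ]; rewrite Tb1 T1.
    case=> t3 [/fP [-> fy]] [t4 [/clearP ->]]; rewrite T1 T0 => ->.
    by rewrite Sb S0; split=> //; exists y.
  case=> -[y fy] ->; exists (T i y); split.
    by apply/guessP; exists y; rewrite Sscr.
  exists (T i y.+1); split; first by rewrite /sem /= Tb1 T1.
  exists (T i y.+1); split; first exact/fP.
  exists (S i); split; first by apply/clearP; rewrite T1 T0.
  by rewrite /sem /= Sb S0.
have loopP t : rs (Star body) (S 0) t <-> exists i,
    (forall j, j < i -> exists y, reval f [tuple of j :: vals s a] y.+1) /\ t = S i.
  split.
    move=> st; have: exists i, (forall j, j < i ->
        exists y, reval f [tuple of j :: vals s a] y.+1) /\ S 0 = S i.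
      by exists 0.
    elim: st => // t1 t2 t3 + _ IH [i [li et]]; rewrite {}et => /bodyP [fi et].
    apply: IH; exists i.+1; split=> // j; rewrite ltnS leq_eqVlt => /orP[/eqP->//|].
    exact: li.
  case=> i [li ->]; elim: i li => [|i IH] li; first by constructor.
  apply: star_trans (IH (fun j ji => li j (ltnW ji))) _.
  by apply: star_one; apply/bodyP; split=> //; apply: li.
have eP i t : rs (eqtest b o b.+2) (S i) t <-> t = S i /\ i = s o.
  have := @eqtestP b o b.+2 (S i) t.
  by rewrite Sb (Slt _ o) // Sscr //; apply; lia.
split.
  case=> t1 [st1]; have /loopP [i [li ->]] : rs (Star body) (S 0) t1 by rewrite S00.
  case=> [t2 [/eP [-> ei]]].
  (* The last check reads [b.+1] as its output register, which is clear and thus holds the required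
     0. *)
  by rewrite -(T0 i) => -[t3 [/fP [-> fi]]] /clearP ->; rewrite T0 S0 S00 -ei.
case=> -> /= [fo lo]; exists (S (s o)); split.
  have : rs (Star body) (S 0) (S (s o)) by apply/loopP; exists (s o).
  by rewrite S00.
exists (S (s o)); split; first exact/eP.
exists (S (s o)); split; first by rewrite -T0; apply/fP.
by apply/clearP; rewrite S0 S00.
Qed.

Lemma checkP n (f : recf n) : checks f.
Proof.
elim: f => [m||m i|m k f IHf g IHg|m f IHf g IHg|m f IHf].
- exact: checks_rzero.
- exact: checks_rsucc.
- exact: checks_rproj.
- exact: checks_rcomp.
- exact: checks_rprec.
- exact: checks_rmu.
Qed.

(** * Computing the code of an instance *)

Fixpoint rconst n (c : nat) : recf n :=
  if c is c'.+1 then rcomp rsucc (fun _ : 'I_1 => rconst n c') else rzero n.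

Definition app1 n (f : recf 1) (g : recf n) : recf n := rcomp f (fun _ : 'I_1 => g).

Definition app2 n (f : recf 2) (g h : recf n) : recf n :=
  rcomp f (fun i : 'I_2 => if val i == 0 then g else h).

Lemma reval_app1 n f (g : recf n) v x y :
  reval g v x -> reval f [tuple x] y -> reval (app1 f g) v y.
Proof. by move=> gx fy; exists [tuple x]; split=> // i; rewrite (ord1 i). Qed.

Lemma reval_app2 n f (g h : recf n) v x x' y :
  reval g v x -> reval h v x' -> reval f [tuple x; x'] y ->
  reval (app2 f g h) v y.
Proof.
move=> gx hx' fy; exists [tuple x; x']; split=> //.
by case=> [[|[|]]] // ?; rewrite /tnth /=.
Qed.

Lemma reval_rconst n c (v : n.-tuple nat) : reval (rconst n c) v c.
Proof. by elim: c => // c IH; apply: (reval_app1 IH). Qed.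

Definition rdouble : recf 1 :=
  rprec (rzero 0) (app1 rsucc (app1 rsucc (rproj (@Ordinal 2 1 isT)))).

Lemma reval_rdouble x : reval rdouble [tuple x] x.*2.
Proof.
apply/reval_rprec; rewrite theadE [[tuple of behead _]]tuple0.
elim: x => [|x IH] //; apply: prec_loopS IH _.
apply: (@reval_app1 _ _ _ _ x.*2.+1) => //.
exact: (@reval_app1 _ _ _ _ x.*2).
Qed.

(** Computes [code (x :: s)] from [x] and [code s]: the recursion starts from the odd number
    [(code s).*2.+1] and doubles it [x] times. *)
Definition rcode_cons : recf 2 :=
  rprec (app1 rsucc rdouble) (app1 rdouble (rproj (@Ordinal 3 1 isT))).

Lemma reval_rcode_cons x y : reval rcode_cons [tuple x; y] (2 ^ x * y.*2.+1).
Proof.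
apply/reval_rprec; rewrite theadE.
have -> : [tuple of behead [tuple x; y]] = [tuple y] by apply: val_inj.
elim: x => [|x IH].
  by rewrite mul1n; apply: reval_app1 (reval_rdouble y) _.
apply: prec_loopS IH _; rewrite expnS -mulnA mul2n.
by apply: reval_app1 (reval_rdouble _).
Qed.

Definition rcode n (fs : seq (recf n)) : recf n :=
  foldr (app2 rcode_cons) (rzero n) fs.

(* An inductive predicate rather than a fixpoint, because reduction must never
   reach the unary codes inside [rconst]: they are astronomically large. *)
Inductive revals n (v : n.-tuple nat) : seq (recf n) -> seq nat -> Prop :=
| RevalsNil : revals v [::] [::]
| RevalsCons f fs y ys : reval f v y -> revals v fs ys ->
    revals v (f :: fs) (y :: ys).

Lemma reval_rcode n (fs : seq (recf n)) v ys :
  revals v fs ys -> reval (rcode fs) v (code ys).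
Proof.
elim=> [//|f {}fs y {}ys fy _ fsys].
exact: reval_app2 fy fsys (reval_rcode_cons _ _).
Qed.

Definition codes (E : seq edge) : nat := code (map code_rule (map rule_of E)).

Lemma codes_cons e E :
  codes (e :: E) = 2 ^ code_rule (rule_of e) * (codes E).*2.+1.
Proof. by []. Qed.

(** Mirrors [load]: in the recursion step, argument 0 is the chain position and argument 1 the code
    of the edges built so far. *)
Definition rload : recf 2 :=
  rprec (rproj (@Ordinal 1 0 isT))
    (app2 rcode_cons
      (rcode [:: app1 rdouble (rproj (@Ordinal 3 0 isT));
                 rconst 3 (code_packet (pkt 0)); rconst 3 0;
                 rconst 3 (code (map code_output [:: (pkt 0, 2)]));
                 app1 rdouble (app1 rsucc (rproj (@Ordinal 3 0 isT)))])
      (rproj (@Ordinal 3 1 isT))).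

Lemma reval_rload k E : reval rload [tuple k; codes E] (codes (load k E)).
Proof.
apply/reval_rprec; rewrite theadE.
have -> : [tuple of behead [tuple k; codes E]] = [tuple codes E] by apply: val_inj.
elim: k => [|k IH]; first by [].
apply: prec_loopS IH _; rewrite [load _ _]/= codes_cons.
set v := [tuple of _].
have rk : reval (rproj (@Ordinal 3 0 isT)) v k by [].
have rsk : reval (app1 rsucc (rproj (@Ordinal 3 0 isT))) v k.+1.
  by apply: (reval_app1 rk).
have rc : reval (rproj (@Ordinal 3 1 isT)) v (codes (load k E)) by [].
apply: reval_app2 _ rc (reval_rcode_cons _ _); apply: reval_rcode.
apply: RevalsCons (reval_app1 rk (reval_rdouble _)) _.
do 3 apply: RevalsCons (reval_rconst _ _) _.
exact: RevalsCons (reval_app1 rsk (reval_rdouble _)) (RevalsNil _).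
Qed.

(** The rules run on their own code. The bound [(codes E).*2] on the states is easy to compute and
    covers both the chain and, by [codes_le], the targets of [E]. *)
Definition diag_inst (E : seq edge) : instance :=
  qinst (codes E).*2 (map rule_of (input (codes E) E)).

(** Only the description of the control depends on [E]; the other components are constants and can
    be read off any [qinst]. *)
Definition rdiag : recf 1 :=
  let r0 := rproj (@Ordinal 1 0 isT) in
  let x := qinst 0 [::] in
  rcode [:: rconst 1 (i_hosts x); rconst 1 (i_tags x);
            rconst 1 (code (map code_pair (i_edges x)));
            rconst 1 (code (map code_send (i_sends x)));
            rcode [:: rcode [:: app1 rdouble r0;
                        app2 rcode_cons
                          (rcode [:: app1 rdouble r0;
                                     rconst 1 (code_packet (pkt 2));
                                     rconst 1 0; rconst 1 (code [::]); rconst 1 1])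
                          (app2 rload r0 r0)];
                      rconst 1 (code_mbox relay)];
            rconst 1 (code (i_Hi x));
            rconst 1 (code (map code_packet (i_Pi x)))].

Lemma reval_rdiag E : reval rdiag [tuple codes E] (code_instance (diag_inst E)).
Proof.
have r0 : reval (rproj (@Ordinal 1 0 isT)) [tuple codes E] (codes E) by [].
have rd : reval (app1 rdouble (rproj (@Ordinal 1 0 isT))) [tuple codes E] (codes E).*2.
  exact: reval_app1 r0 (reval_rdouble _).
apply: reval_rcode; do 4 apply: RevalsCons (reval_rconst _ _) _.
apply: RevalsCons _ (RevalsCons (reval_rconst _ _)
  (RevalsCons (reval_rconst _ _) (RevalsNil _))).
apply: reval_rcode; apply: RevalsCons _ (RevalsCons (reval_rconst _ _) (RevalsNil _)).
apply: reval_rcode; apply: RevalsCons (rd) (RevalsCons _ (RevalsNil _)).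
rewrite -/(codes (input (codes E) E)) codes_cons.
apply: reval_app2 _ (reval_app2 r0 r0 (reval_rload _ _)) (reval_rcode_cons _ _).
apply: reval_rcode; apply: RevalsCons (rd) _.
do 4 apply: RevalsCons (reval_rconst _ _) _.
exact: RevalsNil.
Qed.

(** Since [2 ^ y] exceeds [y], a code exceeds every entry; nested codes therefore bound every number
    occurring in a rule. *)
Lemma mem_code_lt s x : x \in s -> x < code s.
Proof.
elim: s => //= y s IH; rewrite inE.
have p : 0 < (code s).*2.+1 by [].
case/orP=> [/eqP->|/IH xs].
  by apply: leq_trans (ltn_expl y (isT : 1 < 2)) _; rewrite leq_pmulr.
apply: leq_trans xs _; apply: leq_trans (leq_pmull _ (expn_gt0 2 y)); lia.
Qed.

Lemma r_dst_lt r : r_dst r < code_rule r.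
Proof. by apply: mem_code_lt; rewrite !inE eqxx !orbT. Qed.

Lemma codes_le E q l q' : (q, l, q') \in E -> q' < codes E.
Proof.
move=> eE; apply: (@leq_trans (code_rule (rule_of (q, l, q'))).+1); last first.
  by apply: mem_code_lt; rewrite -map_comp; apply: (map_f (code_rule \o rule_of) eE).
have dst : r_dst (rule_of (q, l, q')) = q' by case: (l) => [|[]|].
by have := ltnW (r_dst_lt (rule_of (q, l, q'))); rewrite dst.
Qed.

(** Nonemptiness makes [codes E] positive, which leaves room for state 1, the target of the first
    edge. *)
Lemma input_le E q l q' : E != [::] ->
  (q, l, q') \in input (codes E) E -> q' <= (codes E).*2.
Proof.
case: E => // -[[q0 l0] q0'] E _.
have E0 := codes_le (mem_head (q0, l0, q0') E).
rewrite inE => /orP[/eqP[_ _ ->]|/loadP[[k [kn _ _ ->]]|/codes_le]].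
- by rewrite double_gt0 (leq_ltn_trans _ E0).
- by rewrite leq_double.
- by move=> /ltnW /leq_trans -> //; rewrite -addnn leq_addr.
Qed.

(** * The diagonal argument *)

Section Halting.

Variable g : recf 1.

(** Register 0 holds the input, register 1 the expected value 1, and the registers from 2 on are
    scratch space. *)
Definition test_prog : prog ract := Atom (Inc 1) >> check g [tuple 0] 1 2.

Definition halt_prog : prog qact := compile (width test_prog) test_prog.

Lemma halt_progP n :
  (exists w, sem qsem halt_prog (nseq n false) w) <-> reval g [tuple n] 1.
Proof.
pose s : store := upd (fun=> 0) 0 n.
have K2 : 1 < width test_prog by rewrite /= leq_max.
(* The loaded word is read as [n] copies of symbol 0. *)
have rep : represents (width test_prog) (nseq n false) s.
  exists (nseq n 0); split.
  - by elim: n {s} => //= n ->.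
  - by rewrite all_nseq (ltnW K2) orbT.
  - by move=> r; rewrite count_nseq /s /upd /= eq_sym; case: eqP; rewrite ?mul1n.
pose s1 := upd s 1 1.
have v1 : vals s1 [tuple 0] = [tuple n] by apply: val_inj.
have cP t : sem rsem (check g [tuple 0] 1 2) s1 t <-> t = s1 /\ reval g [tuple n] 1.
  by have := @checkP _ g [tuple 0] 1 2 s1 t; rewrite v1; apply=> // -[|[]].
split=> [[w /(compile_sound (leqnn _) rep) [t [t1 [-> /cP [_ //]]]]]|gn].
have st : sem rsem test_prog s s1 by exists s1; split=> //; apply/cP.
have [w hw _] := compile_complete (leqnn _) rep st.
by exists w.
Qed.

End Halting.

Theorem theorem1 :
  ~ exists f : recf 1,
      forall x : instance,
        finite_state (inst_net x) ->
        ~ forwarding_loop (inst_net x) ->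
        (isolation (inst_Hi x) (inst_Pi x) ->
           reval f [tuple code_instance x] 1) /\
        (~ isolation (inst_Hi x) (inst_Pi x) ->
           reval f [tuple code_instance x] 0).
Proof.
case=> f decides.
(* The rules [E] check whether [f] answers 1 on the instance built from the rules it is given; [x]
   applies them to themselves. *)
pose g := app1 f rdiag; pose E := prog_edges (halt_prog g).
pose x := diag_inst E.
have gE : reval g [tuple codes E] 1 <-> reval f [tuple code_instance x] 1.
  split=> [[w [rw fw]]|fx]; last exact: reval_app1 (reval_rdiag E) fx.
  (* The intermediate value of the composition is existentially quantified; functionality of [rdiag]
     forces it to be the code of [x]. *)
  suff <- : w = [tuple code_instance x] by [].
  have w0 : tnth w ord0 = code_instance x.
    exact: (reval_functional (f := rdiag) (rw ord0) (reval_rdiag E)).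
  by apply: eq_from_tnth => i; rewrite (ord1 i) w0 tnth0.
have fin : finite_state (inst_net x).
  by move=> m; exists (md_last (inst_mbox m)).+1, id => q; exists q.
have [iso1 iso0] := decides x fin (@no_forwarding_loop _ _).
have accE : accepts (input (codes E) E) <-> reval f [tuple code_instance x] 1.
  exact: iff_trans (accepts_input _ _) (iff_trans (halt_progP g _) gE).
(* If [x] were isolated, [f] would answer 1, so the automaton would accept and the forbidden packet
   could be received. *)
have niso : ~ isolation (inst_Hi x) (inst_Pi x).
  move=> iso; apply: (iso); apply: accepts_received (accE.2 (iso1 iso)).
  by move=> q l q'; apply: input_le.
(* Non-isolation is a doubly negated existence, and the goal is absurdity, so a receiving run may be
   assumed constructively: it makes [f] answer 1, whereas non-isolation makes it answer 0. *)
by apply: (niso) => /received_accepts /accE f1;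
  have := reval_functional f1 (iso0 niso).
Qed.
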